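(* Let $n\ge 1$ be an integer and let $(E,\tau)$ be a monotone $\sigma$-complete $n$-state effect algebra such that $E$ satisfies (RDP). Then there exist a nonempty set $\Omega$, an effect-tribe $\mathcal T\subseteq [0,1]^\Omega$ satisfying (RDP), and a function $g:\Omega\to\Omega$ with $g^n=g$ and $f\circ g\in\mathcal T$ for every $f\in\mathcal T$, such that the mapping $\mathcal T_g:\mathcal T\to\mathcal T$, $\mathcal T_g(f):=f\circ g$, is a monotone $\sigma$-complete $n$-state-operator on $\mathcal T$ (so $(\mathcal T,\mathcal T_g)$ is a monotone $\sigma$-complete $n$-state effect algebra). Moreover, there is a monotone $\sigma$-complete state-homomorphism $h$ from $\mathcal T$ onto $E$, so that $h\circ\mathcal T_g=\tau\circ h$.
   Context: An effect algebra is a partial algebra $(E;+,0,1)$ with a partial binary operation $+$ such that for all $a,b,c\in E$: (i) $a+b$ is defined iff $b+a$ is, and then they are equal; (ii) $a+b$ and $(a+b)+c$ are defined iff $b+c$ and $a+(b+c)$ are defined, and then $(a+b)+c=a+(b+c)$; (iii) for each $a$ there is a unique $a'$ with $a+a'=1$; (iv) if $a+1$ is defined then $a=0$. The order is $a\le b$ iff $a+c=b$ for some $c\in E$. $E$ satisfies (RDP) (Riesz Decomposition Property) if $x_1+x_2=y_1+y_2$ implies there are $c_{11},c_{12},c_{21},c_{22}\in E$ with $x_1=c_{11}+c_{12}$, $x_2=c_{21}+c_{22}$, $y_1=c_{11}+c_{21}$, $y_2=c_{12}+c_{22}$. A homomorphism $h:E\to F$ of effect algebras satisfies $h(1)=1$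 and $h(a+b)=h(a)+h(b)$ whenever $a+b$ is defined in $E$; an endomorphism is a homomorphism $E\to E$. An $n$-state-operator on $E$ is an endomorphism $\tau:E\to E$ with $\tau^n=\tau$ ($n$-fold composition); then $(E,\tau)$ is an $n$-state effect algebra. $E$ is monotone $\sigma$-complete if every ascending (descending) sequence in $E$ that is bounded above (below) in $E$ has a supremum (infimum) in $E$. Write $a_i\nearrow a$ if $a_i\le a_{i+1}$ for all $i\ge1$ and $a=\bigvee_i a_i$. An $n$-state-operator $\tau$ is monotone $\sigma$-complete if $a_i\nearrow a$ implies $\tau(a)=\bigvee_i\tau(a_i)$. An $n$-state effect algebra $(E,\tau)$ is monotone $\sigma$-complete if $E$ is monotone $\sigma$-complete and $\tau$ is monotone $\sigma$-complete. A state-homomorphism $h:(E_1,\tau_1)\to(E_2,\tau_2)$ is a homomorphism $h:E_1\to E_2$ with $h\circ\tau_1=\tau_2\circ h$; it is monotone $\sigma$-complete if $a_i\nearrow a$ implies $h(a_i)\nearrow h(a)$. An effect-tribe on a set $\Omega\neq\emptyset$ is a system $\mathcal T\subseteq[0,1]^\Omega$ such that (i) $1\in\mathcal T$; (ii) $f\in\mathcal T$ implies $1-f\in\mathcal T$; (iii) $f,g\in\mathcal T$, $f\le 1-g$ pointwise imply $f+g\in\mathcal T$; (iv) if $f_k\in\mathcal T$ and $f_k(\omega)\nearrow f(\omega)$ for every $\omega\in\Omega$, then $f\in\mathcal T$. It is an effect algebra under pointwise addition ($f+g$ defined iff $f\le 1-g$). *)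

(* Defs.v *)
From mathcomp Require Import all_boot all_order all_algebra.
From mathcomp Require Import boolp classical_sets reals.
Set Implicit Arguments.
Unset Strict Implicit.
Unset Printing Implicit Defensive.
Import Order.TTheory GRing.Theory Num.Theory.

Local Open Scope classical_set_scope.
Local Open Scope ring_scope.

(* The partial sum is option-valued: [ea_add a b = None] means that a + b is
   undefined.  The equations [ea_addC] and [ea_addA] therefore also assert
   that one side is defined iff the other one is.  The degenerate algebra with
   0 = 1 is not excluded. *)
Record effectAlgebra : Type := EffectAlgebra {
  ea_sort :> Type;
  ea_add : ea_sort -> ea_sort -> option ea_sort;
  ea_zero : ea_sort;
  ea_one : ea_sort;
  ea_addC : forall a b, ea_add a b = ea_add b a;
  ea_addA : forall a b c,
    obind (fun s => ea_add s c) (ea_add a b) =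
    obind (fun s => ea_add a s) (ea_add b c);
  ea_orthosupp : forall a, exists! a', ea_add a a' = Some ea_one;
  ea_add1 : forall a, (exists s, ea_add a ea_one = Some s) -> a = ea_zero
}.

Arguments ea_zero {e}.
Arguments ea_one {e}.

Section EffectAlgebraTheory.
Variable E : effectAlgebra.
Implicit Types (a b : E) (s : nat -> E).

Definition ea_le a b : Prop := exists c, ea_add a c = Some b.

Definition ea_is_sup s a : Prop :=
  (forall i, ea_le (s i) a) /\ forall b, (forall i, ea_le (s i) b) -> ea_le a b.

Definition ea_is_inf s a : Prop :=
  (forall i, ea_le a (s i)) /\ forall b, (forall i, ea_le b (s i)) -> ea_le b a.

Definition ea_ascending s : Prop := forall i, ea_le (s i) (s i.+1).

Definition ea_descending s : Prop := forall i, ea_le (s i.+1) (s i).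

Definition ea_increases_to s a : Prop := ea_ascending s /\ ea_is_sup s a.

Definition RDP : Prop :=
  forall x1 x2 y1 y2 z : E,
    ea_add x1 x2 = Some z -> ea_add y1 y2 = Some z ->
    exists c11 c12 c21 c22 : E,
      [/\ ea_add c11 c12 = Some x1, ea_add c21 c22 = Some x2,
          ea_add c11 c21 = Some y1 & ea_add c12 c22 = Some y2].

Definition monotone_sigma_complete : Prop :=
  (forall s, ea_ascending s -> (exists b, forall i, ea_le (s i) b) ->
     exists a, ea_is_sup s a) /\
  (forall s, ea_descending s -> (exists b, forall i, ea_le b (s i)) ->
     exists a, ea_is_inf s a).

End EffectAlgebraTheory.

Definition ea_hom (E F : effectAlgebra) (h : E -> F) : Prop :=
  h ea_one = ea_one /\
  forall a b c : E, ea_add a b = Some c -> ea_add (h a) (h b) = Some (h c).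

Definition n_state_operator (n : nat) (E : effectAlgebra) (tau : E -> E) :
  Prop := ea_hom tau /\ iter n tau =1 tau.

Definition op_monotone_sigma_complete (E : effectAlgebra) (tau : E -> E) :
  Prop :=
  forall (s : nat -> E) (a : E),
    ea_increases_to s a -> ea_is_sup (tau \o s) (tau a).

Definition monotone_sigma_complete_n_state (n : nat) (E : effectAlgebra)
    (tau : E -> E) : Prop :=
  [/\ n_state_operator n tau, monotone_sigma_complete E
    & op_monotone_sigma_complete tau].

Definition state_hom (E1 E2 : effectAlgebra) (tau1 : E1 -> E1)
    (tau2 : E2 -> E2) (h : E1 -> E2) : Prop :=
  ea_hom h /\ h \o tau1 =1 tau2 \o h.

Definition hom_monotone_sigma_complete (E F : effectAlgebra) (h : E -> F) :
  Prop :=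
  forall (s : nat -> E) (a : E),
    ea_increases_to s a -> ea_increases_to (h \o s) (h a).

Record effect_tribe (R : realType) (Omega : Type) (T : set (Omega -> R)) :
  Prop := EffectTribe {
  tribe_nonempty : inhabited Omega;
  tribe_itv : forall f, T f -> forall w, 0 <= f w <= 1;
  tribe_one : T (fun=> 1);
  tribe_compl : forall f, T f -> T (fun w => 1 - f w);
  tribe_sum : forall f g, T f -> T g -> (forall w, f w <= 1 - g w) ->
    T (fun w => f w + g w);
  tribe_lim : forall (f_ : nat -> Omega -> R) (f : Omega -> R),
    (forall k, T (f_ k)) ->
    (forall w, (forall k, f_ k w <= f_ k.+1 w) /\
               supremums (range (fun k => f_ k w)) (f w)) ->
    T f
}.

(* The carrier of the effect algebra is [set_type T], that is, the functions
   belonging to T. *)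
Section TribeEffectAlgebra.
Variables (R : realType) (Omega : Type) (T : set (Omega -> R)).
Hypothesis tribeT : effect_tribe T.
Implicit Types f g k : set_type T.

Lemma tribe_memP f : T (val f).
Proof. exact: set_mem (valP f). Qed.

Definition tribe_elt (f : Omega -> R) (Tf : T f) : set_type T :=
  exist (fun x => x \in T) f (mem_set Tf).

Lemma tribe_zero_proof : T (fun=> 0).
Proof.
have -> : (fun=> 0) = (fun w : Omega => 1 - 1 : R).
  by apply/funext => w; rewrite subrr.
exact: tribe_compl (tribe_one tribeT).
Qed.

Definition tribe_zero : set_type T := tribe_elt tribe_zero_proof.

Definition tribe_unit : set_type T := tribe_elt (tribe_one tribeT).

Definition tribe_add f g : option (set_type T) :=
  match pselect (forall w, val f w <= 1 - val g w) with
  | left le_fg =>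
      Some (tribe_elt (tribe_sum tribeT (tribe_memP f) (tribe_memP g) le_fg))
  | right _ => None
  end.

Lemma tribe_addP f g k :
  tribe_add f g = Some k <-> forall w, val f w + val g w = val k w.
Proof.
rewrite /tribe_add; case: pselect => [le_fg|nle_fg]; split => //.
- by case=> <-.
- move=> fgk; congr Some; apply: val_inj; apply/funext => w; exact: fgk.
- move=> fgk; case: nle_fg => w; rewrite lerBrDr fgk.
  by have /andP[] := tribe_itv tribeT (tribe_memP k) w.
Qed.

Lemma option_ext (X : Type) (o1 o2 : option X) :
  (forall x, o1 = Some x <-> o2 = Some x) -> o1 = o2.
Proof.
case: o1 => [x|] eq12; first by rewrite (eq12 x).1.
by case: o2 eq12 => // x /(_ x)[_ /(_ erefl)].
Qed.

Lemma tribe_addC f g : tribe_add f g = tribe_add g f.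
Proof.
apply: option_ext => k; rewrite !tribe_addP.
by split=> fgk w; rewrite addrC.
Qed.

Lemma tribe_add_le f g : (forall w, val f w + val g w <= 1) ->
  exists2 k, tribe_add f g = Some k & forall w, val k w = val f w + val g w.
Proof.
move=> fg1; rewrite /tribe_add; case: pselect => [le_fg|]; first by eexists.
by case=> w; rewrite lerBrDr.
Qed.

Lemma tribe_addA f g k :
  obind (fun s => tribe_add s k) (tribe_add f g) =
  obind (fun s => tribe_add f s) (tribe_add g k).
Proof.
have itv x w : 0 <= val x w <= 1 := tribe_itv tribeT (tribe_memP x) w.
apply: option_ext => x; split.
- case fg: tribe_add => [s|//] /= /tribe_addP skx.
  move/tribe_addP: fg => fgs.
  have [w|t -> gkt] := @tribe_add_le g k.
    have /andP[_] := itv x w; apply: le_trans.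
    by rewrite -skx -fgs -addrA lerDr; have /andP[] := itv f w.
  by apply/tribe_addP => w; rewrite gkt addrA fgs skx.
- case gk: tribe_add => [s|//] /= /tribe_addP fsx.
  move/tribe_addP: gk => gks.
  have [w|t -> fgt] := @tribe_add_le f g.
    have /andP[_] := itv x w; apply: le_trans.
    by rewrite -fsx -gks addrA lerDl; have /andP[] := itv k w.
  by apply/tribe_addP => w; rewrite fgt -addrA gks fsx.
Qed.

Lemma tribe_orthosupp f : exists! f', tribe_add f f' = Some tribe_unit.
Proof.
exists (tribe_elt (tribe_compl tribeT (tribe_memP f))); split.
  by apply/tribe_addP => w /=; rewrite addrC subrK.
move=> f' /tribe_addP ff'; apply: val_inj; apply/funext => w /=.
by have /= <- := ff' w; rewrite addrC addKr.
Qed.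

Lemma tribe_add1 f : (exists s, tribe_add f tribe_unit = Some s) ->
  f = tribe_zero.
Proof.
case=> s /tribe_addP fs; apply: val_inj; apply/funext => w /=.
have /andP[f0 _] := tribe_itv tribeT (tribe_memP f) w.
have /andP[_] := tribe_itv tribeT (tribe_memP s) w.
by rewrite -fs /= gerDr => fle0; apply/eqP; rewrite eq_le fle0.
Qed.

Definition tribe_ea : effectAlgebra :=
  EffectAlgebra tribe_addC tribe_addA tribe_orthosupp tribe_add1.

Definition tribe_comp (g : Omega -> Omega)
    (Tg : forall f : Omega -> R, T f -> T (f \o g)) : tribe_ea -> tribe_ea :=
  fun f : set_type T => tribe_elt (Tg _ (tribe_memP f)).

End TribeEffectAlgebra.

Arguments tribe_comp {R Omega T} tribeT {g} Tg.

(* Main.v *)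
(* Take for Omega the set of all functions w : E -> R and g w := w \o tau. A
   property of w holds "almost everywhere" if it follows from countably many
   conditions of the form: w is normalised, w is additive at a + b = c, w
   preserves the limit of s_i increasing to a. The tribe consists of the f
   with values in [0, 1] for which some a in E satisfies f w = w a almost
   everywhere, and h f := a. Everything then rests on one fact: if w a <= w b
   almost everywhere then a <= b.
     That is, when a <= b fails, some w with w b < w a satisfies countably many
   given conditions. By (RDP), E is the unit interval of a partially ordered
   group with interpolation, and monotone sigma-completeness passes to this
   group, which is therefore integrally closed: x <= 0 whenever all multiples
   of x have a common upper bound. Call g nonpositive on h when every common
   lower bound of h and g is <= 0, which in the Dedekind completion says that
   the positive parts of h and g are disjoint; integral closedness makes these
   g stable under sums. A generic decreasing sequence of elements h that are
   not <= 0, starting at n (a - b) - 1, decides the sign of each m 1 - k e and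
   makes every decreasing sequence with infimum 0 arbitrarily small. The total
   preorder obtained from it is archimedean up to infinitesimals, which yields
   w. *)
From HB Require Import structures.
Require Import Defs.
From mathcomp Require Import all_boot all_order all_algebra.
From mathcomp Require Import boolp classical_sets functions reals.
From mathcomp Require Import ring lra zify.
Set Implicit Arguments.
Unset Strict Implicit.
Unset Printing Implicit Defensive.
Import Order.TTheory GRing.Theory Num.Theory.

Local Open Scope classical_set_scope.
Local Open Scope ring_scope.

(** * Refinement of finite sums in an effect algebra *)

Section EffectAlgebraSums.
Variable E : effectAlgebra.
Implicit Types a b c d s t : E.

(** The orthosupplement of 1 is 0 by [ea_add1], so [1 + 0 = 1]. Hence [a' + (a + 0) = 1], and [a]
    and [a + 0] are both the orthosupplement of [a']. *)
Lemma ea_addr0 a : ea_add a ea_zero = Some a.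
Proof.
have add10 : ea_add ea_one ea_zero = Some (ea_one : E).
  have [x [x1 _]] := ea_orthosupp (ea_one : E).
  by rewrite -{1}(@ea_add1 E x) //; exists ea_one; rewrite ea_addC.
have [a' [aa' _]] := ea_orthosupp a.
have := ea_addA a' a ea_zero; rewrite (ea_addC a' a) aa' /= add10.
case: (ea_add a ea_zero) => [s|//] /= /esym a's.
have [x [_ x_uniq]] := ea_orthosupp a'.
by rewrite -[s]x_uniq // -[a]x_uniq // ea_addC.
Qed.

Lemma ea_add0r a : ea_add ea_zero a = Some a.
Proof. by rewrite ea_addC ea_addr0. Qed.

(* The partial sum becomes a total commutative monoid on [option E], where
   [None] is absorbing; finite sums are big operators there. *)
Definition oadd (x y : option E) : option E :=
  obind (fun a => obind (ea_add a) y) x.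

Lemma oaddA : associative oadd.
Proof.
move=> [a|] [b|] [c|] //=; last by case: (ea_add a b).
by have /= := ea_addA a b c => <-.
Qed.

Lemma oaddC : commutative oadd.
Proof. by move=> [a|] [b|] //=; exact: ea_addC. Qed.

Lemma oadd0 : left_id (Some ea_zero) oadd.
Proof. by case=> //= a; exact: ea_add0r. Qed.

HB.instance Definition _ :=
  Monoid.isComLaw.Build (option E) (Some ea_zero) oadd oaddA oaddC oadd0.

Arguments oadd : simpl never.

Lemma oaddE a b : oadd (Some a) (Some b) = ea_add a b.
Proof. by []. Qed.

Lemma oadd_Some x y c : oadd x y = Some c ->
  exists a b, [/\ x = Some a, y = Some b & ea_add a b = Some c].
Proof. by case: x y => [a|] [b|] //=; exists a, b. Qed.

(** With [c'] the orthosupplement of [c], both [b] and [b'] are orthosupplements of [a + c']. *)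
Lemma ea_add_cancel a b b' c :
  ea_add a b = Some c -> ea_add a b' = Some c -> b = b'.
Proof.
move=> abc ab'c; have [c' [cc' _]] := ea_orthosupp c.
have oE x : ea_add a x = Some c ->
    oadd (Some x) (oadd (Some a) (Some c')) = Some ea_one.
  by move=> axc; rewrite oaddA (oaddC (Some x)) oaddE axc.
have [b0 [d [[->] adE b'd]]] := oadd_Some (oE _ ab'c).
have := oE _ abc; rewrite adE oaddE => bd.
have [x [_ x_uniq]] := ea_orthosupp d.
by rewrite -[LHS]x_uniq -1?[RHS]x_uniq // ea_addC.
Qed.

Lemma ea_add_eq0 a b : ea_add a b = Some ea_zero -> a = ea_zero.
Proof.
move=> ab0.
have : oadd (Some a) (oadd (Some b) (Some ea_one)) = Some ea_one.
  by rewrite oaddA oaddE ab0 oadd0.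
move=> /oadd_Some[_ [d [_ bd _]]].
have b0 : b = ea_zero by apply: ea_add1; exists d.
by move: ab0; rewrite b0 ea_addr0 => -[].
Qed.

Lemma ea_le_refl a : ea_le a a.
Proof. by exists ea_zero; exact: ea_addr0. Qed.

Lemma ea_le_trans b a c : ea_le a b -> ea_le b c -> ea_le a c.
Proof.
move=> [x ax] [y by_].
have : oadd (Some a) (oadd (Some x) (Some y)) = Some c by rewrite oaddA oaddE ax.
by move=> /oadd_Some[_ [z [[<-] _ az]]]; exists z.
Qed.

Lemma ea_le_anti a b : ea_le a b -> ea_le b a -> a = b.
Proof.
move=> [x ax] [y by_].
have : oadd (Some a) (oadd (Some x) (Some y)) = Some a by rewrite oaddA oaddE ax.
move=> /oadd_Some[_ [z [[<-] xy az]]].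
have z0 := ea_add_cancel az (ea_addr0 a).
move: xy; rewrite oaddE z0 => /ea_add_eq0 x0.
by move: ax; rewrite x0 ea_addr0 => -[].
Qed.

Lemma ea_le1 a : ea_le a ea_one.
Proof. by have [a' [aa' _]] := ea_orthosupp a; exists a'. Qed.

Lemma ea_add_defined a b b' : ea_add b b' = Some ea_one -> ea_le a b' ->
  exists c, ea_add a b = Some c.
Proof.
move=> bb' [x ax].
have : oadd (oadd (Some a) (Some b)) (Some x) = Some ea_one.
  by rewrite -oaddA [oadd (Some b) _]oaddC oaddA oaddE ax oaddC oaddE.
by move=> /oadd_Some[c [_ [abc _ _]]]; exists c.
Qed.

Local Notation "\osum_ ( i <- s ) F" := (\big[oadd/Some ea_zero]_(i <- s) F)
  (at level 36, F at level 36, i, s at level 50).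
Local Notation "\osum_ i F" := (\big[oadd/Some ea_zero]_i F)
  (at level 36, F at level 36, i at level 0).

Lemma osum_mem_Some (I : eqType) (s : seq I) (F : I -> option E) z i :
  \osum_(i <- s) F i = Some z -> i \in s -> exists v, F i = Some v.
Proof.
move=> sz i_s; move: sz; rewrite (big_rem i) //=.
by move=> /oadd_Some[v [_ [-> _ _]]]; exists v.
Qed.

Lemma osum_eq0 (I : eqType) (s : seq I) (x : I -> E) i :
  \osum_(i <- s) Some (x i) = Some ea_zero -> i \in s -> x i = ea_zero.
Proof.
move=> sz i_s; move: sz; rewrite (big_rem i) //=.
by move=> /oadd_Some[v [b [[<-] _]]] /ea_add_eq0.
Qed.

(** * Common refinements of two finite families under (RDP) *)

Section Refinement.
Hypothesis E_RDP : RDP E.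

(** Binary (RDP) splits off the head of the list; what remains of [x1] and [x2] is distributed over
    the tail by induction. *)
Lemma RDP_seq (J : eqType) (y : J -> E) (s : seq J) x1 x2 z : uniq s ->
  ea_add x1 x2 = Some z -> \osum_(j <- s) Some (y j) = Some z ->
  exists c d : J -> E, [/\ {in s, forall j, ea_add (c j) (d j) = Some (y j)},
    \osum_(j <- s) Some (c j) = Some x1 & \osum_(j <- s) Some (d j) = Some x2].
Proof.
elim: s x1 x2 z => [|j s ih] x1 x2 z.
  rewrite big_nil => _ xz [z0]; exists y, y; rewrite !big_nil.
  move: xz; rewrite -z0 => xz; split=> //; first by rewrite (ea_add_eq0 xz).
  by rewrite (@ea_add_eq0 x2 x1) // ea_addC.
move=> /= /andP[j_s s_uniq] xz; rewrite big_cons.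
move=> /oadd_Some[_ [r [[<-] sr yr]]].
have [c1 [c2 [d1 [d2 [cx1 dx2 cy dr]]]]] := E_RDP xz yr.
have [c [d [cdy cs ds]]] := ih _ _ _ s_uniq dr sr.
exists (fun i => if i == j then c1 else c i),
  (fun i => if i == j then d1 else d i).
have same (f : J -> E) v : \osum_(i <- s) Some (if i == j then v else f i) =
    \osum_(i <- s) Some (f i).
  apply: eq_big_seq => i i_s; case: eqP => // ij.
  by rewrite -ij i_s in j_s.
rewrite !big_cons eqxx !same cs ds; split=> // i; rewrite inE.
by case: eqVneq => [->//|_] /= /cdy.
Qed.

Lemma RDP_matrix (I J : finType) (x : I -> E) (y : J -> E) z :
  \osum_i Some (x i) = Some z -> \osum_j Some (y j) = Some z ->
  exists c : I -> J -> E, (forall i, \osum_j Some (c i j) = Some (x i)) /\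
    (forall j, \osum_i Some (c i j) = Some (y j)).
Proof.
move=> xz yz.
(* The column sums [w] vary in the induction: each step takes one row [c] out of the columns, and
   the remainders [d] are the column sums for the other rows. *)
suff main (s : seq I) (w : J -> E) t : uniq s ->
    \osum_(i <- s) Some (x i) = Some t -> \osum_j Some (w j) = Some t ->
    exists c : I -> J -> E, {in s, forall i, \osum_j Some (c i j) = Some (x i)} /\
      (forall j, \osum_(i <- s) Some (c i j) = Some (w j)).
  have [c [cx cy]] := main _ _ _ (index_enum_uniq I) xz yz.
  by exists c; split=> // i; apply: cx; rewrite mem_index_enum.
elim: s w t => [|i s ih] w t.
  rewrite big_nil => _ [<-] w0; exists (fun _ _ => ea_zero); split=> // j.
  by rewrite big_nil (osum_eq0 w0) // mem_index_enum.
move=> /= /andP[i_s s_uniq]; rewrite big_cons.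
move=> /oadd_Some[_ [r [[<-] sr xr]]] wt.
have [c [d [cdw cx dr]]] := RDP_seq (index_enum_uniq J) xr wt.
have [e [ex ed]] := ih _ _ s_uniq sr dr.
exists (fun k j => if k == i then c j else e k j); split=> [k|j].
  rewrite inE; case: eqVneq => [->//|_] /= /ex //.
have := cdw j (mem_index_enum j); rewrite big_cons eqxx => <-.
rewrite [X in oadd _ X](_ : _ = Some (d j)) // -ed.
apply: eq_big_seq => k k_s; case: eqP => // ki.
by rewrite -ki k_s in i_s.
Qed.

(* The two finite families represent the same element of the universal group
   of E. *)
Definition equirefined (I J : finType) (x : I -> E) (y : J -> E) :=
  exists c : I -> J -> E, (forall i, \osum_j Some (c i j) = Some (x i)) /\
    (forall j, \osum_i Some (c i j) = Some (y j)).

Lemma equirefined_sym (I J : finType) (x : I -> E) (y : J -> E) :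
  equirefined x y -> equirefined y x.
Proof. by move=> [c [cx cy]]; exists (fun j i => c i j). Qed.

(** Column [j] of [c] and row [j] of [d] both sum to [y j]. Refining them against each other gives a
    three-index array, whose sum over [j] matches [x] with [z]. *)
Lemma equirefined_trans (I J K : finType) (x : I -> E) (y : J -> E) (z : K -> E) :
  equirefined x y -> equirefined y z -> equirefined x z.
Proof.
move=> [c [cx cy]] [d [dy dz]].
have /choice[e eP] : forall j, exists e : I -> K -> E,
    (forall i, \osum_k Some (e i k) = Some (c i j)) /\
    (forall k, \osum_i Some (e i k) = Some (d j k)).
  by move=> j; exact: RDP_matrix (cy j) (dy j).
have xE i : \osum_k \osum_j Some (e j i k) = Some (x i).
  rewrite exchange_big /= -cx; apply: eq_bigr => j _; by have [-> _] := eP j.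
have /choice[f fE] : forall ik : I * K, exists v,
    \osum_j Some (e j ik.1 ik.2) = Some v.
  by move=> [i k]; exact: osum_mem_Some (xE i) (mem_index_enum k).
exists (fun i k => f (i, k)); split=> [i|k].
  by rewrite -xE; apply: eq_bigr => k _; rewrite -(fE (i, k)).
rewrite -dz (eq_bigr (fun i => \osum_j Some (e j i k))); last first.
  by move=> i _; rewrite -(fE (i, k)).
rewrite exchange_big; apply: eq_bigr => j _; by have [_ ->] := eP j.
Qed.

Definition sum_fam (I J : Type) (x : I -> E) (y : J -> E) (k : I + J) : E :=
  match k with inl i => x i | inr j => y j end.

Lemma osum_sumType (I J : finType) (F : I + J -> option E) :
  \osum_k F k = oadd (\osum_i F (inl i)) (\osum_j F (inr j)).
Proof. exact: big_sumType. Qed.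

Lemma equirefined_sum (I J I' J' : finType) (x : I -> E) (y : J -> E)
    (x' : I' -> E) (y' : J' -> E) :
  equirefined x y -> equirefined x' y' ->
  equirefined (sum_fam x x') (sum_fam y y').
Proof.
move=> [c [cx cy]] [d [dx dy]].
exists (fun k l => match k, l with
  | inl i, inl j => c i j | inr i, inr j => d i j | _, _ => ea_zero end).
have z (K : finType) : \osum_(k <- index_enum K) Some ea_zero = Some (ea_zero : E).
  by rewrite big1.
by split=> -[i|i] /=;
  rewrite osum_sumType z ?cx ?dx ?cy ?dy oaddE ?ea_addr0 ?ea_add0r.
Qed.

(* The entry common to the row and the column of a is cancelled, and what
   remains of that row and that column is refined against each other. *)
Lemma equirefined_cancel (I J : finType) a (x : I -> E) (y : J -> E) :
  equirefined (sum_fam (fun _ : 'I_1 => a) x) (sum_fam (fun _ : 'I_1 => a) y) ->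
  equirefined x y.
Proof.
move=> [c [cx cy]].
pose o := inl ord0 : 'I_1 + I; pose o' := inl ord0 : 'I_1 + J.
have := cx o; rewrite osum_sumType big_ord1 => /oadd_Some[_ [r [[<-] rE ar]]].
have := cy o'; rewrite osum_sumType big_ord1 => /oadd_Some[_ [r' [[<-] r'E ar']]].
have rr := ea_add_cancel ar ar'; rewrite -{}rr {r' ar'} in r'E.
have [e [eI eJ]] := RDP_matrix r'E rE.
have xE i : \osum_j oadd (Some (e i j)) (Some (c (inr i) (inr j))) = Some (x i).
  by rewrite big_split /= eI -(cx (inr i)) osum_sumType big_ord1.
have yE j : \osum_i oadd (Some (e i j)) (Some (c (inr i) (inr j))) = Some (y j).
  by rewrite big_split /= eJ -(cy (inr j)) osum_sumType big_ord1.
have /choice[f fE] : forall ij : I * J, exists v,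
    oadd (Some (e ij.1 ij.2)) (Some (c (inr ij.1) (inr ij.2))) = Some v.
  by move=> [i j]; exact: osum_mem_Some (xE i) (mem_index_enum j).
exists (fun i j => f (i, j)); split=> [i|j].
  by rewrite -xE; apply: eq_bigr => j _; rewrite -(fE (i, j)).
by rewrite -yE; apply: eq_bigr => i _; rewrite -(fE (i, j)).
Qed.

End Refinement.
End EffectAlgebraSums.

Arguments oadd {E} x y : simpl never.

(** * Preordered groups *)

Lemma sequence_choice (T : Type) (P : nat -> T -> Prop)
    (Q : nat -> T -> T -> Prop) :
  (exists x, P 0%N x) ->
  (forall n x, P n x -> exists y, P n.+1 y /\ Q n x y) ->
  exists f : nat -> T, (forall n, P n (f n)) /\
                       forall n, Q n (f n) (f n.+1).
Proof.
move=> /cid[x0 Px0] step.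
have next n (x : {x | P n x}) : {y : {y | P n.+1 y} | Q n (sval x) (sval y)}.
  by have /cid[y [Py Qy]] := step n _ (svalP x); exists (exist _ y Py).
pose f := nat_rect (fun n => {x | P n x}) (exist _ x0 Px0)
                   (fun n x => sval (next n x)).
exists (fun n => sval (f n)); split => n; first exact: svalP (f n).
exact: svalP (next n (f n)).
Qed.

Lemma fct_mulrnE (X : Type) (x : X -> int) n t : (x *+ n) t = x t *+ n.
Proof. by elim: n => [|n ih]; rewrite ?mulr0n // !mulrSr -ih. Qed.

Lemma fct_addE (X : Type) (x y : X -> int) t : (x + y) t = x t + y t.
Proof. by []. Qed.

Lemma fct_oppE (X : Type) (x : X -> int) t : (- x) t = - x t.
Proof. by []. Qed.

Lemma fct_zeroE (X : Type) t : (0 : X -> int) t = 0.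
Proof. by []. Qed.

Ltac fct_ring :=
  apply/funext => ?;
  rewrite ?(fct_addE, fct_oppE, fct_zeroE, fct_mulrnE); ring.

Section PreorderedGroup.
Variables (X : Type) (C : set (X -> int)).
Hypothesis cone0 : C 0.
Hypothesis coneD : forall x y, C x -> C y -> C (x + y).
Implicit Types (x y z g h l p u : X -> int) (k m n : nat).

Definition cone_le x y := C (y - x).
Local Notation "x <=C y" := (cone_le x y) (at level 70).

(** Inequalities are derived as sums of known ones; what remains is an identity between differences,
    settled pointwise by [fct_ring]. *)
Lemma cone_le_of1 x y a b : a <=C b -> y - x = b - a -> x <=C y.
Proof. by rewrite /cone_le => ? ->. Qed.

Lemma cone_le_of2 x y a b a' b' : a <=C b -> a' <=C b' ->
  y - x = b - a + (b' - a') -> x <=C y.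
Proof. by rewrite /cone_le => ? ? ->; apply: coneD. Qed.

Lemma cone_le_of3 x y a b a' b' a'' b'' : a <=C b -> a' <=C b' ->
  a'' <=C b'' -> y - x = b - a + (b' - a') + (b'' - a'') -> x <=C y.
Proof. by rewrite /cone_le => ? ? ? ->; apply/coneD => //; apply: coneD. Qed.

Lemma cone_le_refl x : x <=C x.
Proof. by rewrite /cone_le subrr. Qed.

Lemma cone_le_trans y x z : x <=C y -> y <=C z -> x <=C z.
Proof. by move=> xy yz; apply: (cone_le_of2 xy yz); fct_ring. Qed.

Lemma cone_le_mulrn x y k : x <=C y -> x *+ k <=C y *+ k.
Proof.
move=> xy; elim: k => [|k ih]; first exact: cone_le_refl.
by apply: (cone_le_of2 xy ih); fct_ring.
Qed.

Lemma cone_mulrn_ge0 x k : 0 <=C x -> 0 <=C x *+ k.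
Proof. by move=> /(cone_le_mulrn k); rewrite mul0rn. Qed.

Lemma cone_ascending_le (s : nat -> X -> int) :
  (forall n, s n <=C s n.+1) -> forall m n, (m <= n)%N -> s m <=C s n.
Proof.
move=> s_incr m; elim=> [|n ih].
  by rewrite leqn0 => /eqP->; exact: cone_le_refl.
rewrite leq_eqVlt => /predU1P[->|]; first exact: cone_le_refl.
by rewrite ltnS => /ih /cone_le_trans; apply.
Qed.

(** * Interpolation and suprema of sequences imply integral closedness *)

Section IntegrallyClosed.

Hypothesis interpolation : forall a1 a2 b1 b2,
  a1 <=C b1 -> a1 <=C b2 -> a2 <=C b1 -> a2 <=C b2 ->
  exists z, [/\ a1 <=C z, a2 <=C z, z <=C b1 & z <=C b2].

(** A Riesz decomposition of each [z k] below [t + q], chosen so that both parts ascend: the next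
    [v] is interpolated above [v k] and [z k.+1 - q], and below [t] and [z k.+1 - (z k - v k)]. *)
Lemma ascending_decomposition (z : nat -> X -> int) t q :
  0 <=C t -> 0 <=C q -> (forall k, z k <=C z k.+1) ->
  (forall k, 0 <=C z k) -> (forall k, z k <=C t + q) ->
  exists v : nat -> X -> int,
    (forall k, [/\ 0 <=C v k, v k <=C t, v k <=C z k & z k - v k <=C q]) /\
    (forall k, v k <=C v k.+1 /\ z k - v k <=C z k.+1 - v k.+1).
Proof.
move=> t0 q0 z_incr z0 z_le.
apply: (@sequence_choice _
  (fun k v => [/\ 0 <=C v, v <=C t, v <=C z k & z k - v <=C q])
  (fun k v w => v <=C w /\ z k - v <=C z k.+1 - w)) => [|k v [v0 vt vz zvq]].
  have [||v [v0 zqv vt vz]] := interpolation t0 (z0 0%N) (a2 := z 0%N - q).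
  - by apply: (cone_le_of1 (z_le 0%N)); fct_ring.
  - by apply: (cone_le_of1 q0); fct_ring.
  by exists v; split=> //; apply: (cone_le_of1 zqv); fct_ring.
have [||||w [vw zqw wt wzv]] := @interpolation v (z k.+1 - q) t (z k.+1 - (z k - v)).
- exact: vt.
- by apply: (cone_le_of1 (z_incr k)); fct_ring.
- by apply: (cone_le_of1 (z_le k.+1)); fct_ring.
- by apply: (cone_le_of1 zvq); fct_ring.
exists w; split; last by split=> //; apply: (cone_le_of1 wzv); fct_ring.
split=> //; first exact: cone_le_trans vw.
  by apply: (cone_le_of2 wzv vz); fct_ring.
by apply: (cone_le_of1 zqw); fct_ring.
Qed.

Hypothesis sup_ascending : forall s : nat -> X -> int,
  (forall n, s n <=C s n.+1) -> (exists y, forall n, s n <=C y) ->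
  exists z, (forall n, s n <=C z) /\ forall y, (forall n, s n <=C y) -> z <=C y.

Lemma inf_descending (s : nat -> X -> int) :
  (forall n, s n.+1 <=C s n) -> (exists y, forall n, y <=C s n) ->
  exists z, (forall n, z <=C s n) /\ forall y, (forall n, y <=C s n) -> y <=C z.
Proof.
move=> s_decr [y y_lb].
have [n||z [z_ub z_lub]] := @sup_ascending (fun n => - s n).
- by apply: (cone_le_of1 (s_decr n)); fct_ring.
- by exists (- y) => n; apply: (cone_le_of1 (y_lb n)); fct_ring.
exists (- z); split=> [n|x x_lb].
  by apply: (cone_le_of1 (z_ub n)); fct_ring.
have zx : z <=C - x.
  by apply: z_lub => n; apply: (cone_le_of1 (x_lb n)); fct_ring.
by apply: (cone_le_of1 zx); fct_ring.
Qed.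

(** Finite interpolation gives an ascending sequence below [a] and [b] whose term [n] is above
    [x n]; its supremum is the interpolant. *)
Lemma countable_interpolation (x : nat -> X -> int) a b :
  (forall j, x j <=C a) -> (forall j, x j <=C b) ->
  exists s, [/\ forall j, x j <=C s, s <=C a & s <=C b].
Proof.
move=> xa xb.
have [|n z [xz za zb]|s [s_bd s_incr]] := @sequence_choice _
    (fun n s => [/\ x n <=C s, s <=C a & s <=C b]) (fun n s t => s <=C t).
- by exists (x 0%N); split=> //; exact: cone_le_refl.
- have [t [zt xt ta tb]] := interpolation za zb (xa n.+1) (xb n.+1).
  by exists t; split.
have [|z [z_ub z_lub]] := @sup_ascending s s_incr.
  by exists a => n; case: (s_bd n).
exists z; split=> [j||]; last 2 first.
- by apply: z_lub => n; case: (s_bd n).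
- by apply: z_lub => n; case: (s_bd n).
by apply: cone_le_trans (z_ub j); case: (s_bd j).
Qed.

(* The proof builds y = y_0 >= y_1 >= ... above all multiples of x with
   y_n - y_(n+1) >= x; the infimum z of the y_n satisfies x + z <= z. *)
Lemma cone_integrally_closed x y : (forall k, x *+ k <=C y) -> x <=C 0.
Proof.
move=> xy.
have [|n z xz|s [s_ge s_step]] := @sequence_choice _
    (fun n s => forall k, x *+ k <=C s)
    (fun n s t => t <=C s /\ x <=C s - t).
- by exists y.
(* Since [x *+ k.+1 <= z] for all [k], the element [z - x] also bounds all multiples of [x]. *)
- have [k|t [xt tz tzx]] := @countable_interpolation (fun k => x *+ k) z (z - x) xz.
    by apply: (cone_le_of1 (xz k.+1)); fct_ring.
  by exists t; split=> //; split=> //; apply: (cone_le_of1 tzx); fct_ring.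
have [n||z [z_lb z_glb]] := @inf_descending s.
- by case: (s_step n).
- by exists 0 => n; have := s_ge n 0%N; rewrite mulr0n.
have xzz : x + z <=C z.
  apply: z_glb => n; have [_ xs] := s_step n.
  by apply: (cone_le_of2 xs (z_lb n.+1)); fct_ring.
by apply: (cone_le_of1 xzz); fct_ring.
Qed.

End IntegrallyClosed.

(** * Forcing signs below elements that are not nonpositive *)

Section Forcing.
Variable u : X -> int.
Hypothesis u_ge0 : 0 <=C u.
Hypothesis integrally_closed :
  forall x y, (forall k, x *+ k <=C y) -> x <=C 0.

Definition cone_bounded g := exists k, g <=C u *+ k.

Lemma cone_bounded_le g h : g <=C h -> cone_bounded h -> cone_bounded g.
Proof. by move=> gh [k hk]; exists k; apply: cone_le_trans hk. Qed.

Lemma cone_boundedD g h :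
  cone_bounded g -> cone_bounded h -> cone_bounded (g + h).
Proof.
by move=> [k gk] [m hm]; exists (k + m)%N; apply: (cone_le_of2 gk hm); fct_ring.
Qed.

(* If v is an upper bound of 0 and p, then so is v - x. *)
Lemma le0_of_meet_join h p x : cone_bounded p ->
  (forall l, l <=C h -> l <=C p -> l <=C 0) -> x <=C h ->
  (forall g, 0 <=C g -> p <=C g -> x <=C g) -> x <=C 0.
Proof.
move=> [k0 pk0] hp xh x_le.
have main k : 0 <=C u *+ k0 - x *+ k /\ p <=C u *+ k0 - x *+ k.
  elim: k => [|k [n0 pn]].
    by rewrite mulr0n subr0; split=> //; apply: cone_mulrn_ge0.
  have xn := x_le _ n0 pn; split; first by apply: (cone_le_of1 xn); fct_ring.
  have : p + x - (u *+ k0 - x *+ k) <=C 0.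
    apply: hp; last by apply: (cone_le_of1 xn); fct_ring.
    by apply: (cone_le_of2 pn xh); fct_ring.
  by move=> l0; apply: (cone_le_of1 l0); fct_ring.
apply: (integrally_closed (y := u *+ k0)) => k; have [l0 _] := main k.
by apply: (cone_le_of1 l0); fct_ring.
Qed.

(* In the Dedekind completion of the group this says that the positive parts
   of h and g are disjoint. *)
Definition forces_le0 h g :=
  cone_bounded g /\ forall l, l <=C h -> l <=C g -> l <=C 0.

Lemma forces_le0_of_le0 h g : g <=C 0 -> forces_le0 h g.
Proof.
move=> g0; split; first by exists 0%N; rewrite mulr0n.
by move=> l _ lg; apply: cone_le_trans g0.
Qed.

Lemma forces_le0_le h g g' : g' <=C g -> forces_le0 h g -> forces_le0 h g'.
Proof.
move=> g'g [g_bd hg]; split; first exact: cone_bounded_le g_bd.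
by move=> l lh lg'; apply: hg => //; apply: cone_le_trans g'g.
Qed.

Lemma forces_le0_stronger h h' g :
  h' <=C h -> forces_le0 h g -> forces_le0 h' g.
Proof.
move=> h'h [g_bd hg]; split=> // l lh'.
by apply: hg; apply: cone_le_trans h'h.
Qed.

(** Let [l] be below [h] and [g + g']. If [v] bounds 0 and [g'], then [l - v] is below [h] and [g],
    so [l <= v]. Thus [l] is below the positive part of [g'], which [le0_of_meet_join] turns into
    [l <= 0]. *)
Lemma forces_le0D h g g' :
  forces_le0 h g -> forces_le0 h g' -> forces_le0 h (g + g').
Proof.
move=> [g_bd hg] [g'_bd hg']; split; first exact: cone_boundedD.
move=> l lh lgg'; apply: (le0_of_meet_join g'_bd hg' lh) => v v0 g'v.
have lv : l - v <=C 0.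
  apply: hg; first by apply: (cone_le_of2 lh v0); fct_ring.
  by apply: (cone_le_of2 lgg' g'v); fct_ring.
by apply: (cone_le_of1 lv); fct_ring.
Qed.

Lemma forces_le0_mulrn h g k : forces_le0 h g -> forces_le0 h (g *+ k).
Proof.
move=> hg; elim: k => [|k ih]; last by rewrite mulrS; apply: forces_le0D.
by rewrite mulr0n; apply/forces_le0_of_le0/cone_le_refl.
Qed.

(** Take [m] with [h <= u *+ m]. If [h] forced a positive multiple of [u] to be nonpositive, it
    would force [u *+ m] too; being below itself and [u *+ m], it would be nonpositive. *)
Lemma not_forces_unit h k :
  cone_bounded h -> ~ h <=C 0 -> ~ forces_le0 h (u *+ k.+1).
Proof.
move=> [m hm] h_nle0 hu; apply: h_nle0.
have [_] : forces_le0 h (u *+ m).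
  have := forces_le0_mulrn m hu; apply: forces_le0_le.
  by apply: (cone_le_of1 (cone_mulrn_ge0 (k * m) u_ge0)); fct_ring.
by apply=> //; exact: cone_le_refl.
Qed.

(** Even multiples of [l] are nonpositive and odd ones are at most [l], so all are bounded by a
    multiple of [u] and integral closedness applies. *)
Lemma le0_of_double h l : cone_bounded h -> l <=C h -> l + l <=C 0 -> l <=C 0.
Proof.
move=> [m hm] lh ll0; apply: (integrally_closed (y := u *+ m)) => k.
have um := cone_mulrn_ge0 m u_ge0.
rewrite -(odd_double_half k) -muln2.
case: (odd k); rewrite ?add0n ?add1n; last first.
  apply: (cone_le_of2 (cone_le_mulrn k./2 ll0) um).
  by fct_ring.
apply: (cone_le_of3 (cone_le_mulrn k./2 ll0) lh hm).
by fct_ring.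
Qed.

Lemma forces_le0_of_le_opp h g :
  cone_bounded g -> cone_bounded h -> h <=C - g -> forces_le0 h g.
Proof.
move=> g_bd h_bd hg; split=> // l lh lg.
by apply: (le0_of_double h_bd lh); apply: (cone_le_of3 lg hg lh); fct_ring.
Qed.

(** If [h] does not force [g] to be nonpositive, a witness [l] of this failure lies below [g] and so
    forces [- g] to be nonpositive. *)
Lemma forcing_decides h g : cone_bounded h -> ~ h <=C 0 ->
  cone_bounded g -> cone_bounded (- g) ->
  exists l, [/\ l <=C h, ~ l <=C 0 & forces_le0 l g \/ forces_le0 l (- g)].
Proof.
move=> h_bd h_nle0 g_bd gN_bd.
have [hg|nhg] := pselect (forces_le0 h g).
  by exists h; split; [exact: cone_le_refl|by []|left].
have [l [lh lg l_nle0]] : exists l, [/\ l <=C h, l <=C g & ~ l <=C 0].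
  apply: contrapT => H; apply: nhg; split=> // l lh lg.
  by apply: contrapT => ?; apply: H; exists l.
exists l; split=> //; right; apply: forces_le0_of_le_opp => //.
  exact: cone_bounded_le h_bd.
by rewrite opprK.
Qed.

(* Otherwise every l below h and u would be below n * b i for all i. *)
Lemma forcing_inf0 h n (b : nat -> X -> int) : cone_bounded h -> ~ h <=C 0 ->
  (forall i, 0 <=C b i) -> (forall i, b i <=C u) ->
  (forall i, b i.+1 <=C b i) ->
  (forall l, (forall i, l <=C b i) -> l <=C 0) ->
  exists l, [/\ l <=C h, ~ l <=C 0 & exists i, forces_le0 l (b i *+ n - u)].
Proof.
move=> h_bd h_nle0 b_ge0 b_leu b_decr b_inf.
have b_mono i j : (i <= j)%N -> b j <=C b i.
  move=> /(@cone_ascending_le (fun i => - b i)) => H.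
  have : - b i <=C - b j.
    by apply: H => k; apply: (cone_le_of1 (b_decr k)); fct_ring.
  by move=> bij; apply: (cone_le_of1 bij); fct_ring.
have inf_mulrn l : (forall i, l <=C b i *+ n) -> l <=C 0.
  elim: n l => [|n ih] l lb; first by have := lb 0%N; rewrite mulr0n.
  apply: ih => i.
  have : l - b i *+ n <=C 0.
    apply: b_inf => j; have := lb (maxn i j); rewrite mulrS => lb'.
    apply: (cone_le_of3 lb' (b_mono j (maxn i j) (leq_maxr _ _))
              (cone_le_mulrn n (b_mono i (maxn i j) (leq_maxl _ _)))).
    by fct_ring.
  by move=> l0; apply: (cone_le_of1 l0); fct_ring.
have [[i [l [lh lub l_nle0]]]|H] := pselect (exists i l,
    [/\ l <=C h, l <=C u - b i *+ n & ~ l <=C 0]).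
  exists l; split=> //; exists i; apply: forces_le0_of_le_opp.
  - by exists n; apply: (cone_le_of2 (cone_le_mulrn n (b_leu i)) u_ge0); fct_ring.
  - exact: cone_bounded_le h_bd.
  - by apply: (cone_le_of1 lub); fct_ring.
exfalso; apply: (@not_forces_unit h 0%N) => //; rewrite mulr1n; split.
  by exists 1%N; rewrite mulr1n; exact: cone_le_refl.
move=> l lh lu; apply: inf_mulrn => i.
have : l - b i *+ n <=C 0.
  apply: contrapT => l_nle0; apply: H; exists i, (l - b i *+ n); split=> //.
    by apply: (cone_le_of2 lh (cone_mulrn_ge0 n (b_ge0 i))); fct_ring.
  by apply: (cone_le_of1 lu); fct_ring.
by move=> l0; apply: (cone_le_of1 l0); fct_ring.
Qed.

(** A Rasiowa-Sikorski argument: the requirements [Req] are countably many and each can be met below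
    any [h] that is not nonpositive. A decreasing sequence meets them all, and [N] consists of what
    its terms force to be nonpositive. *)
Lemma generic_negative_cone (h0 : X -> int) (e : nat -> X -> int)
    (b : nat -> nat -> X -> int) :
  cone_bounded h0 -> cone_bounded (- h0) -> ~ h0 <=C 0 ->
  (forall i, 0 <=C e i) -> (forall i, e i <=C u) ->
  (forall j i, 0 <=C b j i) -> (forall j i, b j i <=C u) ->
  (forall j i, b j i.+1 <=C b j i) ->
  (forall j l, (forall i, l <=C b j i) -> l <=C 0) ->
  exists N : set (X -> int),
    [/\ forall g, g <=C 0 -> N g, forall g g', N g -> N g' -> N (g + g'),
        forall k, ~ N (u *+ k.+1) & N (- h0)] /\
    [/\ forall i m k, N (u *+ m - e i *+ k) \/ N (e i *+ k - u *+ m)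
      & forall j n, exists i, N (b j i *+ n - u)].
Proof.
move=> h0_bd h0N_bd h0_nle0 e0 eu b0 bu b_decr b_inf.
pose Req (r : nat * nat * nat + nat * nat) l := match r with
  | inl (i, m, k) => forces_le0 l (u *+ m - e i *+ k) \/
                     forces_le0 l (e i *+ k - u *+ m)
  | inr (j, n) => exists i, forces_le0 l (b j i *+ n - u)
  end.
have dense r h : cone_bounded h -> ~ h <=C 0 ->
    exists l, [/\ l <=C h, ~ l <=C 0 & Req r l].
  move=> h_bd h_nle0; case: r => [[[i m] k]|[j n]]; last first.
    exact: (forcing_inf0 n h_bd h_nle0 (b0 j) (bu j) (b_decr j) (b_inf j)).
  have := @forcing_decides h (u *+ m - e i *+ k) h_bd h_nle0; rewrite opprB.
  apply.
    by exists m; apply: (cone_le_of1 (cone_mulrn_ge0 k (e0 i))); fct_ring.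
  exists k; apply: (cone_le_of2 (cone_le_mulrn k (eu i)) (cone_mulrn_ge0 m u_ge0)).
  by fct_ring.
(* Step [n] meets the requirement with code [n] and keeps [h] if there is none. The clause on
   [n = 0] records that the sequence starts at [h0]. *)
have [|n h [h_bd h_nle0]|h [h_ok h_step]] := @sequence_choice _
    (fun n h => [/\ cone_bounded h, ~ h <=C 0 & n = 0%N -> h = h0])
    (fun n h l => l <=C h /\ forall r, unpickle n = Some r -> Req r l).
- by exists h0.
- case E : (unpickle n) => [r|]; last first.
    by exists h; do ?split=> //; exact: cone_le_refl.
  have [l [lh l_nle0 rl]] := dense r h h_bd h_nle0.
  exists l; split; last by split=> // r' [<-].
  split=> //; exact: cone_bounded_le h_bd.
have h_mono m n : (m <= n)%N -> h n <=C h m.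
  move=> /(@cone_ascending_le (fun i => - h i)) H.
  have hmn : - h m <=C - h n.
    by apply: H => k; have [hk _] := h_step k; apply: (cone_le_of1 hk); fct_ring.
  by apply: (cone_le_of1 hmn); fct_ring.
have req r : exists n, Req r (h n).
  by exists (pickle r).+1; have [_] := h_step (pickle r); apply; exact: pickleK.
exists (fun g => exists n, forces_le0 (h n) g); split; split.
- by move=> g g0; exists 0%N; exact: forces_le0_of_le0.
- move=> g g' [n hg] [n' hg']; exists (maxn n n'); apply: forces_le0D.
    by apply: forces_le0_stronger hg; apply/h_mono/leq_maxl.
  by apply: forces_le0_stronger hg'; apply/h_mono/leq_maxr.
- by move=> k [n]; have [h_bd h_nle0 _] := h_ok n; exact: not_forces_unit.
- exists 0%N; have [_ _ ->//] := h_ok 0%N.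
  by apply: forces_le0_of_le_opp => //; rewrite opprK; exact: cone_le_refl.
- move=> i m k; have [n /= [?|?]] := req (inl (i, m, k)); first by left; exists n.
  by right; exists n.
- by move=> j n; have [k [i ?]] := req (inr (j, n)); exists i, k.
Qed.

End Forcing.
End PreorderedGroup.

(** * A real-valued state from a negative cone *)

Section ConeState.
Variables (R : realType) (X : Type) (N : set (X -> int)) (u : X -> int).
Hypothesis N0 : N 0.
Hypothesis ND : forall x y, N x -> N y -> N (x + y).
Hypothesis N_unit : forall k, ~ N (u *+ k.+1).
Implicit Types (x y z : X -> int) (k m n : nat).

Lemma cone_mulrn x k : N x -> N (x *+ k).
Proof.
move=> Nx; elim: k => [|k ih]; first by rewrite mulr0n.
by rewrite mulrS; exact: ND.
Qed.

(* N plays the role of the negative cone of a total order, and cone_state x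
   is the supremum of the m/k with (m/k) u <= x in that order. *)
Definition cone_state_set x : set R :=
  [set q | exists m k, N (u *+ m - x *+ k.+1) /\ q = m%:R / k.+1%:R].

Definition cone_state x : R := sup (cone_state_set x).

Definition cone_decided x :=
  forall m k, N (u *+ m - x *+ k) \/ N (x *+ k - u *+ m).

(** A lower fraction exceeding an upper one would, after clearing denominators, put a positive
    multiple of [u] into [N]. *)
Lemma cone_state_set_le x m k q : cone_state_set x q ->
  N (x *+ k.+1 - u *+ m) -> q <= m%:R / k.+1%:R.
Proof.
move=> [m' [k' [Nx' ->]]] Nx.
rewrite ler_pdivrMr // mulrAC ler_pdivlMr // -!natrM ler_nat leqNgt.
apply/negP => lt_mm.
(* [N_unit] speaks of successors, so its argument is one less than the positive difference of the
   cross products. *)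
apply: (@N_unit (m' * k.+1 - (m * k'.+1).+1)%N).
have -> : u *+ (m' * k.+1 - (m * k'.+1).+1).+1 =
          (u *+ m' - x *+ k'.+1) *+ k.+1 + (x *+ k.+1 - u *+ m) *+ k'.+1.
  rewrite -subSn // subSS mulrnBr; last exact: ltnW.
  by fct_ring.
by apply: ND; exact: cone_mulrn.
Qed.

Section UnitInterval.
Variable x : X -> int.
Hypotheses (x_ge0 : N (- x)) (x_le1 : N (x - u)).

Lemma cone_state_has_sup : has_sup (cone_state_set x).
Proof.
split; last by exists (1%:R / 1%:R) => q /cone_state_set_le; apply; rewrite !mulr1n.
by exists (0%:R / 1%:R), 0%N, 0%N; rewrite mulr0n mulr1n sub0r.
Qed.

Lemma cone_state_ge m k : N (u *+ m - x *+ k.+1) -> m%:R / k.+1%:R <= cone_state x.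
Proof. by move=> Nx; apply: (sup_upper_bound cone_state_has_sup); exists m, k. Qed.

Lemma cone_state_le m k : N (x *+ k.+1 - u *+ m) -> cone_state x <= m%:R / k.+1%:R.
Proof.
move=> Nx; apply: ge_sup; first by case: cone_state_has_sup.
by move=> q /cone_state_set_le; apply.
Qed.

Lemma cone_state_itv : 0 <= cone_state x <= 1.
Proof.
have := @cone_state_ge 0 0; rewrite mulr0n mulr1n sub0r mul0r => -> //.
by have := @cone_state_le 1 0; rewrite !mulr1n divr1; apply.
Qed.

(* Since x <= u the largest m with m u <= k x exists and is at most k. *)
Lemma cone_state_approx k : cone_decided x ->
  exists m, N (u *+ m - x *+ k.+1) /\ N (x *+ k.+1 - u *+ m.+1).
Proof.
move=> x_dec.
pose P m := `[< N (x *+ k.+1 - u *+ m) >].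
have ex_P : exists m, P m.
  by exists k.+1; apply/asboolP; rewrite -mulrnBl; exact: cone_mulrn.
case: (ex_minnP ex_P) => -[|m] /asboolP Nm min_m.
  exists 0%N; split.
    by rewrite mulr0n sub0r -mulNrn; exact: cone_mulrn.
  have -> : x *+ k.+1 - u *+ 1 = (x *+ k.+1 - u *+ 0) + (- x + (x - u)).
    by fct_ring.
  by apply: ND => //; exact: ND.
exists m; split=> //; have [//|Nx] := x_dec m k.+1.
by have := min_m m; rewrite ltnn => /(_ (asboolT Nx)).
Qed.

End UnitInterval.

Lemma eq_of_dist_le_inv (a b c : R) :
  (forall k, `|a - b| <= c / k.+1%:R) -> a = b.
Proof.
move=> ab; apply/eqP; rewrite -subr_eq0 -normr_eq0 eq_le normr_ge0 andbT.
rewrite leNgt; apply/negP => d0.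
pose k := Num.truncn (c / `|a - b|).
have : c / `|a - b| < k.+1%:R by rewrite truncnS_gt.
rewrite ltr_pdivrMr // mulrC -ltr_pdivrMr //.
by rewrite ltNge ab.
Qed.

(** With denominator [k.+1], [x] and [y] are located between consecutive fractions [m], [m.+1] and
    [m'], [m'.+1]. Then [z] lies between [m + m'] and [m + m' + 2], so the error is at most
    [2 / k.+1]. *)
Lemma cone_stateD x y z : N (- x) -> N (x - u) -> N (- y) -> N (y - u) ->
  N (- z) -> N (z - u) -> N (z - (x + y)) -> N (x + y - z) ->
  cone_decided x -> cone_decided y ->
  cone_state z = cone_state x + cone_state y.
Proof.
move=> x0 x1 y0 y1 z0 z1 zxy xyz x_dec y_dec.
apply: (@eq_of_dist_le_inv _ _ 2) => k.
have [m [xm xm1]] := cone_state_approx x0 x1 k x_dec.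
have [m' [ym ym1]] := cone_state_approx y0 y1 k y_dec.
have zm : N (u *+ (m + m') - z *+ k.+1).
  have -> : u *+ (m + m') - z *+ k.+1 = (u *+ m - x *+ k.+1) +
      (u *+ m' - y *+ k.+1) + (x + y - z) *+ k.+1 by fct_ring.
  by apply: ND; [exact: ND|exact: cone_mulrn].
have zm1 : N (z *+ k.+1 - u *+ (m.+1 + m'.+1)).
  have -> : z *+ k.+1 - u *+ (m.+1 + m'.+1) = (x *+ k.+1 - u *+ m.+1) +
      (y *+ k.+1 - u *+ m'.+1) + (z - (x + y)) *+ k.+1 by fct_ring.
  by apply: ND; [exact: ND|exact: cone_mulrn].
have := cone_state_ge x0 x1 xm; have := cone_state_le x0 x1 xm1.
have := cone_state_ge y0 y1 ym; have := cone_state_le y0 y1 ym1.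
have := cone_state_ge z0 z1 zm; have := cone_state_le z0 z1 zm1.
have -> : (m.+1 + m'.+1)%N = (m + m' + 1 + 1)%N by lia.
rewrite -[m.+1]addn1 -[m'.+1]addn1 ![_%:R / _]mulrC; move: (k.+1%:R^-1) => d.
rewrite !natrD !mulrDr !mulr1 => *; rewrite ler_norml.
by apply/andP; split; lra.
Qed.

Lemma cone_state_add_inv x y n : N (- x) -> N (x - u) -> N (- y) -> N (y - u) ->
  N (x *+ n.+1 + u - y *+ n.+1) -> cone_state x + n.+1%:R^-1 <= cone_state y.
Proof.
move=> x0 x1 y0 y1 xy; rewrite -lerBrDr.
apply: ge_sup; first by case: (cone_state_has_sup x0 x1).
move=> _ [m [k [xm ->]]]; rewrite lerBrDr.
(* The common denominator [k.+1 * n.+1] is written as a successor to fit [cone_state_ge]. *)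
have -> : m%:R / k.+1%:R + n.+1%:R^-1 =
    (m * n.+1 + k.+1)%:R / (k * n + k + n).+1%:R :> R.
  have -> : (k * n + k + n).+1 = (k.+1 * n.+1)%N by lia.
  by rewrite !natrD !natrM; field; rewrite !nat1r !pnatr_eq0.
apply: cone_state_ge => //.
have -> : u *+ (m * n.+1 + k.+1) - y *+ (k * n + k + n).+1 =
    (u *+ m - x *+ k.+1) *+ n.+1 + (x *+ n.+1 + u - y *+ n.+1) *+ k.+1.
  by fct_ring.
by apply: ND; exact: cone_mulrn.
Qed.

Lemma cone_state_le_add_inv x y n : N (- x) -> N (x - u) -> N (- y) -> N (y - u) ->
  N (y *+ n.+1 - x *+ n.+1 - u) -> cone_state y <= cone_state x + n.+1%:R^-1.
Proof.
move=> x0 x1 y0 y1 xy.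
apply: ge_sup; first by case: (cone_state_has_sup y0 y1).
move=> _ [m [k [ym ->]]]; rewrite -lerBlDr.
have /andP[wx0 _] := cone_state_itv x0 x1.
have -> : m%:R / k.+1%:R - n.+1%:R^-1 =
    ((m * n.+1)%:R - k.+1%:R) / (k * n + k + n).+1%:R :> R.
  have -> : (k * n + k + n).+1 = (k.+1 * n.+1)%N by lia.
  by rewrite !natrM; field; rewrite !nat1r !pnatr_eq0.
(* If the numerator is negative, nonnegativity of the state at [x] suffices. *)
have [le_k|lt_k] := leqP k.+1 (m * n.+1).
  rewrite -natrB //; apply: cone_state_ge => //.
  have -> : u *+ (m * n.+1 - k.+1) - x *+ (k * n + k + n).+1 =
      (u *+ m - y *+ k.+1) *+ n.+1 + (y *+ n.+1 - x *+ n.+1 - u) *+ k.+1.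
    by rewrite mulrnBr //; fct_ring.
  by apply: ND; exact: cone_mulrn.
apply: le_trans wx0; rewrite pmulr_lle0 ?invr_gt0 // subr_le0 ler_nat.
exact: ltnW.
Qed.

Lemma cone_state_unit : N (- u) -> cone_state u = 1.
Proof.
move=> u0; have uu : N (u - u) by rewrite subrr.
have [_ u1] := andP (cone_state_itv u0 uu).
apply/eqP; rewrite eq_le u1 /=.
by have := @cone_state_ge u u0 uu 1 0; rewrite !mulr1n divr1; apply.
Qed.

End ConeState.
(** * The universal group of an effect algebra *)

Section UniversalGroup.
Variable E : effectAlgebra.
Hypothesis E_RDP : RDP E.
Implicit Types (a b t : E) (g p q r v w : E -> int).

Local Notation "\osum_ ( i <- s ) F" := (\big[@oadd E/Some ea_zero]_(i <- s) F)
  (at level 36, F at level 36, i, s at level 50).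
Local Notation "\osum_ i F" := (\big[@oadd E/Some ea_zero]_i F)
  (at level 36, F at level 36, i at level 0).

(** The basis vector of [a] in the free abelian group on [E]. *)
Definition delta a : E -> int := fun b => (`[< a = b >] : nat)%:R.

Lemma sum_delta_ge (I : eqType) (s : seq I) (x : I -> E) b :
  reflect (exists2 i, i \in s & x i = b) (0 < (\sum_(i <- s) delta (x i)) b).
Proof.
have ge0 i b' : 0 <= delta (x i) b' by rewrite ler0n.
rewrite fct_sumE lt0r sumr_ge0 ?andbT => [|i _]; last exact: ge0.
rewrite psumr_neq0 => [|i _]; last exact: ge0.
apply: (iffP hasP) => -[i i_s].
  by rewrite /delta; case: asboolP => //= xb _; exists i.
by move=> xb; exists i => //; rewrite /delta asboolT.
Qed.

(** Families with the same formal sum agree up to a bijection of indices; the matrix carries the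
    common value at matched indices and zero elsewhere. *)
Lemma matching_matrix (I J : eqType) (s : seq I) (t : seq J) (x : I -> E)
    (y : J -> E) : uniq s -> uniq t ->
  \sum_(i <- s) delta (x i) = \sum_(j <- t) delta (y j) ->
  exists c : I -> J -> E,
    {in s, forall i, \osum_(j <- t) Some (c i j) = Some (x i)} /\
    {in t, forall j, \osum_(i <- s) Some (c i j) = Some (y j)}.
Proof.
elim: s t => [|i s ih] t.
  case: t => [|j t] _ _; first by exists (fun _ _ => ea_zero).
  rewrite big_nil => /(congr1 (fun v => 0 < v (y j))).
  by move/esym/sum_delta_ge => []; exists j; rewrite ?mem_head.
move=> /= /andP[i_s s_uniq] t_uniq st.
have /sum_delta_ge[j j_t yj] : 0 < (\sum_(j <- t) delta (y j)) (x i).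
  by rewrite -st; apply/sum_delta_ge; exists i; rewrite ?mem_head.
have [|c [cx cy]] := ih (rem j t) s_uniq (rem_uniq _ t_uniq).
  move: st; rewrite big_cons (big_rem j) //= yj.
  by move/addrI.
exists (fun k l => if k == i then if l == j then x i else ea_zero
                   else if l == j then ea_zero else c k l).
have jrem l : l \in rem j t -> (l == j) = false.
  by rewrite mem_rem_uniq // inE => /andP[/negbTE].
have js k : k \in s -> (k == i) = false.
  by case: eqP => // -> ; rewrite (negbTE i_s).
split=> [k|l].
  rewrite (big_rem j) //= eqxx inE; case: eqVneq => [->|ki] /= ks.
    by rewrite big1_seq ?oaddE ?ea_addr0 // => l /andP[_ /jrem ->].
  rewrite (eq_big_seq (fun l => Some (c k l))); last first.
    by move=> l /jrem ->.
  by rewrite cx // oaddE ea_add0r.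
rewrite big_cons eqxx => l_t; case: eqVneq => [->|lj].
  rewrite big1_seq ?oaddE ?ea_addr0 ?yj // => k /andP[_ /js -> //].
rewrite (eq_big_seq (fun k => Some (c k l))); last first.
  by move=> k /js ->.
by rewrite cy ?oaddE ?ea_add0r // mem_rem_uniq // inE lj.
Qed.

Definition fam_sum (I : finType) (x : I -> E) : E -> int := \sum_i delta (x i).

Lemma equirefined_fam_sum (I J : finType) (x : I -> E) (y : J -> E) :
  fam_sum x = fam_sum y -> equirefined x y.
Proof.
move=> xy.
have [c [cx cy]] := matching_matrix (index_enum_uniq I) (index_enum_uniq J) xy.
by exists c; split=> k; [apply: cx|apply: cy]; exact: mem_index_enum.
Qed.

Lemma fam_sum_sum (I J : finType) (x : I -> E) (y : J -> E) :
  fam_sum (sum_fam x y) = fam_sum x + fam_sum y.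
Proof. exact: big_sumType. Qed.

Definition fsum_equiv v w := exists (I J : finType) (x : I -> E) (y : J -> E),
  [/\ v = fam_sum x, w = fam_sum y & equirefined x y].

(** The choice of representing families is immaterial: families with equal formal sums are
    equirefined, and equirefinement is transitive. *)
Lemma fsum_equivP (I J : finType) (x : I -> E) (y : J -> E) :
  fsum_equiv (fam_sum x) (fam_sum y) <-> equirefined x y.
Proof.
split; last by exists I, J, x, y.
move=> [I' [J' [x' [y' [xx' yy' x'y']]]]].
apply: (equirefined_trans E_RDP (equirefined_fam_sum xx')).
apply: (equirefined_trans E_RDP x'y'); exact: equirefined_fam_sum.
Qed.

Lemma fsum_equiv_sym v w : fsum_equiv v w -> fsum_equiv w v.
Proof.
move=> [I [J [x [y [-> -> xy]]]]]; exact/fsum_equivP/equirefined_sym.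
Qed.

Lemma fsum_equivD v w v' w' : fsum_equiv v w -> fsum_equiv v' w' ->
  fsum_equiv (v + v') (w + w').
Proof.
move=> [I [J [x [y [-> -> xy]]]]] [I' [J' [x' [y' [-> -> xy']]]]].
by rewrite -!fam_sum_sum; apply/fsum_equivP/equirefined_sum.
Qed.

Definition fsum v := exists (I : finType) (x : I -> E), v = fam_sum x.

Lemma fsum0 : fsum 0.
Proof. by exists 'I_0, (fun _ => ea_zero); rewrite /fam_sum big_ord0. Qed.

Lemma fsumD v w : fsum v -> fsum w -> fsum (v + w).
Proof.
move=> [I [x ->]] [J [y ->]]; rewrite -fam_sum_sum.
by exists (I + J)%type, (sum_fam x y).
Qed.

Lemma fsum_delta a : fsum (delta a).
Proof. by exists 'I_1, (fun _ => a); rewrite /fam_sum big_ord1. Qed.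

Lemma fsum_sum (I : Type) (s : seq I) (F : I -> E -> int) :
  (forall i, fsum (F i)) -> fsum (\sum_(i <- s) F i).
Proof. by move=> Fs; elim/big_ind: _ => //; [exact: fsum0|exact: fsumD]. Qed.

Lemma fsumP v : fsum v -> exists s : seq E, v = \sum_(a <- s) delta a.
Proof.
move=> [I [x ->]]; exists [seq x i | i <- index_enum I].
by rewrite big_map.
Qed.

Lemma fsum_equiv_refl v : fsum v -> fsum_equiv v v.
Proof. by move=> [I [x ->]]; apply/fsum_equivP/equirefined_fam_sum. Qed.

Lemma fsum_equiv_cancel v w g : fsum v -> fsum w -> fsum g ->
  fsum_equiv (g + v) (g + w) -> fsum_equiv v w.
Proof.
move=> v_fsum w_fsum /fsumP[s ->].
elim: s => [|a s ih]; first by rewrite big_nil !add0r.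
rewrite big_cons -!addrA => gvw; apply: ih; move: gvw.
have [I [x ->]] : fsum (\sum_(b <- s) delta b + v).
  by apply: fsumD => //; apply: fsum_sum; exact: fsum_delta.
have [J [y ->]] : fsum (\sum_(b <- s) delta b + w).
  by apply: fsumD => //; apply: fsum_sum; exact: fsum_delta.
have -> : delta a = fam_sum (fun _ : 'I_1 => a) by rewrite /fam_sum big_ord1.
by rewrite -!fam_sum_sum !fsum_equivP; exact: equirefined_cancel.
Qed.

(* The quotient of Z^(E) by this subgroup is the universal group of E; it is
   handled as the preordered group E -> int with the cone below. *)
Definition equiv_kernel v := exists p q, fsum_equiv p q /\ v = p - q.

Lemma fsum_equiv_fsum v w : fsum_equiv v w -> fsum v /\ fsum w.
Proof.
by move=> [I [J [x [y [-> -> _]]]]]; split; [exists I, x|exists J, y].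
Qed.

(** If [p - q = p' - q'] with [p'] equivalent to [q'], then [q' + p = p' + q] is equivalent to
    [q' + q], and [q'] cancels. *)
Lemma kernelP p q : fsum p -> fsum q -> equiv_kernel (p - q) -> fsum_equiv p q.
Proof.
move=> p_fsum q_fsum [p' [q' [pq' E1]]].
have [p'_fsum q'_fsum] := fsum_equiv_fsum pq'.
apply: (@fsum_equiv_cancel _ _ q') => //.
have -> : q' + p = p' + q.
  by rewrite -[p](subrK q) E1; fct_ring.
exact: fsum_equivD pq' (fsum_equiv_refl q_fsum).
Qed.

Lemma kernel0 : equiv_kernel 0.
Proof. by exists 0, 0; split; [exact/fsum_equiv_refl/fsum0|rewrite subrr]. Qed.

Lemma kernelD v w : equiv_kernel v -> equiv_kernel w -> equiv_kernel (v + w).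
Proof.
move=> [p [q [pq ->]]] [p' [q' [pq' ->]]]; exists (p + p'), (q + q').
by split; [exact: fsum_equivD|fct_ring].
Qed.

Lemma kernelN v : equiv_kernel v -> equiv_kernel (- v).
Proof.
move=> [p [q [pq ->]]]; exists q, p.
by split; [exact: fsum_equiv_sym|fct_ring].
Qed.

Lemma kernelB v w : equiv_kernel v -> equiv_kernel w -> equiv_kernel (v - w).
Proof. by move=> ? ?; apply: kernelD => //; exact: kernelN. Qed.

Lemma kernel_sum (I : Type) (s : seq I) (F : I -> E -> int) :
  (forall i, equiv_kernel (F i)) -> equiv_kernel (\sum_(i <- s) F i).
Proof. by move=> Fs; elim/big_ind: _ => //; [exact: kernel0|exact: kernelD]. Qed.

Lemma kernel_osum (J : finType) (c : J -> E) a :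
  \osum_j Some (c j) = Some a -> equiv_kernel (delta a - \sum_j delta (c j)).
Proof.
move=> ca; exists (fam_sum (fun _ : 'I_1 => a)), (fam_sum c); split.
  apply/fsum_equivP; exists (fun _ j => c j); split=> // j.
  by rewrite big_ord1.
by rewrite /fam_sum big_ord1.
Qed.

Lemma kernel_add a b t : ea_add a b = Some t ->
  equiv_kernel (delta t - (delta a + delta b)).
Proof.
move=> abt.
have := @kernel_osum ('I_1 + 'I_1)%type (sum_fam (fun _ => a) (fun _ => b)) t.
by rewrite osum_sumType !big_ord1 big_sumType !big_ord1; apply.
Qed.

Lemma kernel_delta0 : equiv_kernel (delta (ea_zero : E)).
Proof.
have := kernelN (kernel_add (ea_addr0 (ea_zero : E))).
by rewrite opprB addrK.
Qed.

Definition ea_cone : set (E -> int) :=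
  [set v | exists r, fsum r /\ equiv_kernel (v - r)].

Lemma ea_cone_fsum r : fsum r -> ea_cone r.
Proof. by move=> r_fsum; exists r; rewrite subrr; split=> //; exact: kernel0. Qed.

Lemma ea_cone_kernel v : equiv_kernel v -> ea_cone v.
Proof. by move=> vK; exists 0; rewrite subr0; split=> //; exact: fsum0. Qed.

Lemma ea_cone0 : ea_cone 0. Proof. exact/ea_cone_fsum/fsum0. Qed.

Lemma ea_coneD v w : ea_cone v -> ea_cone w -> ea_cone (v + w).
Proof.
move=> [r [r_fsum vr]] [r' [r'_fsum wr']]; exists (r + r').
split; first exact: fsumD.
by rewrite opprD addrACA; exact: kernelD.
Qed.

Local Notation "v <=E w" := (cone_le ea_cone v w) (at level 70).

(** [E] embeds with its order. Conversely, [b] is equivalent to [a] plus a finite sum; the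
    refinement has a single row, so [a] is a summand of [b] in [E]. *)
Lemma ea_le_delta a b : ea_le a b <-> delta a <=E delta b.
Proof.
split=> [[c abc]|[r [[J [y ->]] abr]]].
  exists (delta c); split; first exact: fsum_delta.
  by rewrite -addrA -opprD; exact: kernel_add.
have [|||] := @kernelP (fam_sum (fun _ : 'I_1 => b))
    (fam_sum (sum_fam (fun _ : 'I_1 => a) y)).
- by exists 'I_1, (fun=> b).
- by exists ('I_1 + J)%type, (sum_fam (fun _ : 'I_1 => a) y).
- by rewrite fam_sum_sum /fam_sum !big_ord1 opprD addrA.
move=> ? [? [? [? H]]]; move: H => [E1 E2 H].
have [c [cx cy]] : equirefined (fun _ : 'I_1 => b) (sum_fam (fun _ : 'I_1 => a) y).
  by apply/fsum_equivP; rewrite E1 E2; apply/fsum_equivP.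
have := cx ord0; rewrite osum_sumType big_ord1.
have := cy (inl ord0); rewrite big_ord1 => -[-> ].
by move=> /oadd_Some[_ [d [[<-] _ abd]]]; exists d.
Qed.

(** [t] is refined into the summands of [g] and of [delta t - g]; those belonging to [g] form a
    partial sum of [t], hence have a sum [a] in [E]. *)
Lemma kernel_interval g t : 0 <=E g -> g <=E delta t ->
  exists a, equiv_kernel (g - delta a).
Proof.
rewrite /cone_le subr0 => -[r [[J [y rE]] gr]] [r' [[K [z rE']] tgr']].
have /fsum_equivP[c [cx cy]] : fsum_equiv (fam_sum (fun _ : 'I_1 => t))
    (fam_sum (sum_fam y z)).
  apply: kernelP; first by exists 'I_1, (fun=> t).
    by exists (J + K)%type, (sum_fam y z).
  rewrite fam_sum_sum -rE -rE' /fam_sum big_ord1.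
  have -> : delta t - (r + r') = delta t - g - r' + (g - r) by fct_ring.
  exact: kernelD.
have := cx ord0; rewrite osum_sumType => /oadd_Some[a [b [aE _ _]]].
exists a; have -> : g - delta a = (g - r) - (delta a - r) by fct_ring.
apply: kernelB => //; rewrite rE; apply: kernel_osum; rewrite -aE.
by apply: eq_bigr => j _; have := cy (inl j); rewrite big_ord1.
Qed.

(** As [(w1 - v1) + (w2 - v2) = (w2 - v1) + (w1 - v2)], these differences have a common refinement
    into blocks [A], [B], [C], [D]. The interpolant [v1 + A] exceeds [v2] by [D] and falls short of
    [w1] by [B] and of [w2] by [C]. *)
Lemma ea_cone_interpolation v1 v2 w1 w2 :
  v1 <=E w1 -> v1 <=E w2 -> v2 <=E w1 -> v2 <=E w2 ->
  exists z, [/\ v1 <=E z, v2 <=E z, z <=E w1 & z <=E w2].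
Proof.
move=> [_ [[I1 [x1 ->]] k11]] [_ [[J1 [y1 ->]] k12]].
move=> [_ [[J2 [y2 ->]] k21]] [_ [[I2 [x2 ->]] k22]].
have /fsum_equivP[c [cx cy]] :
    fsum_equiv (fam_sum (sum_fam x1 x2)) (fam_sum (sum_fam y1 y2)).
  apply: kernelP; first by exists (I1 + I2)%type, (sum_fam x1 x2).
    by exists (J1 + J2)%type, (sum_fam y1 y2).
  rewrite !fam_sum_sum.
  have -> : fam_sum x1 + fam_sum x2 - (fam_sum y1 + fam_sum y2) =
      (w2 - v1 - fam_sum y1) + (w1 - v2 - fam_sum y2) -
      ((w1 - v1 - fam_sum x1) + (w2 - v2 - fam_sum x2)) by fct_ring.
  by apply: kernelB; exact: kernelD.
pose A := \sum_i \sum_j delta (c (inl i) (inl j)).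
pose B := \sum_i \sum_j delta (c (inl i) (inr j)).
pose C := \sum_i \sum_j delta (c (inr i) (inl j)).
pose D := \sum_i \sum_j delta (c (inr i) (inr j)).
have fs I J (F : I -> J -> E) (s : seq I) (t : seq J) :
    ea_cone (\sum_(i <- s) \sum_(j <- t) delta (F i j)).
  by apply/ea_cone_fsum/fsum_sum => i; apply: fsum_sum => j; exact: fsum_delta.
have x1K : equiv_kernel (fam_sum x1 - (A + B)).
  rewrite -big_split -sumrB; apply: kernel_sum => i.
  by have := kernel_osum (cx (inl i)); rewrite big_sumType.
have x2K : equiv_kernel (fam_sum x2 - (C + D)).
  rewrite -big_split -sumrB; apply: kernel_sum => i.
  by have := kernel_osum (cx (inr i)); rewrite big_sumType.
have y1K : equiv_kernel (fam_sum y1 - (A + C)).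
  rewrite /A /C exchange_big [\sum_i \sum_j delta (c (inr i) _)]exchange_big.
  rewrite -big_split -sumrB; apply: kernel_sum => j.
  by have := kernel_osum (cy (inl j)); rewrite big_sumType.
have y2K : equiv_kernel (fam_sum y2 - (B + D)).
  rewrite /B /D exchange_big [\sum_i \sum_j delta (c (inr i) _)]exchange_big.
  rewrite -big_split -sumrB; apply: kernel_sum => j.
  by have := kernel_osum (cy (inr j)); rewrite big_sumType.
have le_of v w v' k : ea_cone v' -> equiv_kernel k -> w - v = v' + k -> v <=E w.
  by rewrite /cone_le => v'0 kK ->; apply: ea_coneD => //; exact: ea_cone_kernel.
exists (v1 + A); split.
- by apply: (le_of _ _ _ _ (fs _ _ _ _ _) kernel0); rewrite addr0 addrC addKr.
- apply: (le_of _ _ _ _ (fs _ _ (fun i j => c (inr i) (inr j)) _ _)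
    (kernelB (kernelD k21 y2K) (kernelD k11 x1K))).
  by rewrite -/D; fct_ring.
- apply: (le_of _ _ _ _ (fs _ _ (fun i j => c (inl i) (inr j)) _ _)
    (kernelD k11 x1K)).
  by rewrite -/B; fct_ring.
- apply: (le_of _ _ _ _ (fs _ _ (fun i j => c (inr i) (inl j)) _ _)
    (kernelD k12 y1K)).
  by rewrite -/C; fct_ring.
Qed.

End UniversalGroup.

(** * Suprema in the universal group *)

Section MonotoneSigmaComplete.
Variable E : effectAlgebra.
Hypothesis E_RDP : RDP E.
Hypothesis E_sup : forall s : nat -> E, ea_ascending s ->
  (exists b, forall i, ea_le (s i) b) -> exists a, ea_is_sup s a.
Implicit Types (a b t : E) (g p q r v w : E -> int).

Local Notation "v <=E w" := (cone_le (@ea_cone E) v w) (at level 70).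

Let c0 := ea_cone0 E_RDP.
Let cD := @ea_coneD E E_RDP.
Let le_trans_cone := cone_le_trans cD.
Let leE := ea_le_delta E_RDP.

Lemma delta_ge0 a : 0 <=E delta a.
Proof. by rewrite /cone_le subr0; exact/(ea_cone_fsum E_RDP)/fsum_delta. Qed.

Lemma kernel_le v w : equiv_kernel (v - w) -> v <=E w /\ w <=E v.
Proof.
move=> vw; split; last exact: ea_cone_kernel.
by rewrite /cone_le -opprB; apply: ea_cone_kernel; exact: kernelN.
Qed.

Lemma interval_delta g t : 0 <=E g -> g <=E delta t ->
  exists a, g <=E delta a /\ delta a <=E g.
Proof.
by move=> g0 gt; have [a /kernel_le] := kernel_interval E_RDP g0 gt; exists a.
Qed.

Lemma delta_add a b t : ea_add a b = Some t ->
  delta t <=E delta a + delta b /\ delta a + delta b <=E delta t.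
Proof. by move=> /(kernel_add E_RDP)/kernel_le. Qed.

Lemma delta_zero : delta (ea_zero : E) <=E 0.
Proof.
have [] := @kernel_le (delta ea_zero) 0; rewrite ?subr0 //.
exact: kernel_delta0.
Qed.

Lemma sum_delta_ge0 (s : seq E) : 0 <=E \sum_(a <- s) delta a.
Proof.
rewrite /cone_le subr0; apply/(ea_cone_fsum E_RDP)/fsum_sum; exact: fsum_delta.
Qed.

Lemma cone_le_sum g : 0 <=E g ->
  exists s : seq E, g <=E \sum_(a <- s) delta a /\ \sum_(a <- s) delta a <=E g.
Proof.
rewrite /cone_le subr0 => -[r [/fsumP[s ->] /kernel_le gs]]; by exists s.
Qed.

(** The suprema are taken one at a time: for fixed [j] each [x i] is below the complement of [y j]
    in [c], hence so is [a]; then each [y j] is below the complement of [a]. *)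
Lemma ea_sup_add (x y : nat -> E) a b c :
  ea_ascending x -> ea_ascending y -> ea_is_sup x a -> ea_is_sup y b ->
  (forall k, delta (x k) + delta (y k) <=E delta c) ->
  exists2 d, ea_add a b = Some d & ea_le d c.
Proof.
move=> x_incr y_incr [x_ub x_lub] [y_ub y_lub] xyc.
have le_max (z : nat -> E) i j :
    ea_ascending z -> delta (z i) <=E delta (z (maxn i j)).
  move=> z_incr; have z_incr' k : delta (z k) <=E delta (z k.+1) by exact/leE.
  exact: (cone_ascending_le (s := fun k => delta (z k)) c0 cD z_incr'
    (leq_maxl i j)).
have ay j : delta a + delta (y j) <=E delta c.
  have /leE[t yt] : delta (y j) <=E delta c.
    by apply: (cone_le_of2 cD (delta_ge0 (x j)) (xyc j)); fct_ring.
  have [ct tc] := delta_add yt.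
  suff /leE at_ : ea_le a t by apply: (cone_le_of2 cD at_ tc); fct_ring.
  apply: x_lub => i; apply/leE.
  have := le_max x i j x_incr; have := le_max y j i y_incr; rewrite maxnC => yj xi.
  have sum_le : delta (x i) + delta (y j) <=E delta c.
    by apply: (cone_le_of3 cD xi yj (xyc (maxn i j))); fct_ring.
  by apply: (cone_le_of2 cD sum_le ct); fct_ring.
have /leE[t at_] : delta a <=E delta c.
  by apply: (cone_le_of2 cD (ay 0%N) (delta_ge0 (y 0%N))); fct_ring.
have [ct tc] := delta_add at_.
have [e be] : ea_le b t.
  apply: y_lub => j; apply/leE.
  by apply: (cone_le_of2 cD (ay j) ct); fct_ring.
have : oadd (oadd (Some a) (Some b)) (Some e) = Some c.
  by rewrite -oaddA oaddE be.
by move=> /oadd_Some[d [_ [abd [<-] dc]]]; exists d => //; exists e.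
Qed.

(* Suprema computed in E remain suprema in the group: an upper bound of the
   sequence is equivalent to a sum of elements of E, and the sequence
   decomposes accordingly. *)
Lemma ea_sup_delta_le (x : nat -> E) a g : ea_ascending x -> ea_is_sup x a ->
  (forall k, delta (x k) <=E g) -> delta a <=E g.
Proof.
move=> x_incr x_sup xg.
have [|s [gs sg]] := @cone_le_sum g.
  exact: le_trans_cone (delta_ge0 (x 0%N)) (xg 0%N).
apply: le_trans_cone sg.
have {xg gs} : forall k, delta (x k) <=E \sum_(b <- s) delta b.
  by move=> k; exact: le_trans_cone (xg k) gs.
elim: s x a x_incr x_sup => [|t s ih] x a x_incr [x_ub x_lub].
  rewrite big_nil => x0; apply: le_trans_cone delta_zero.
  by apply/leE/x_lub => k; apply/leE/(le_trans_cone (x0 k))/delta_ge0.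
rewrite big_cons => x_le.
have [k|v [v_bd v_incr]] := ascending_decomposition cD
    (@ea_cone_interpolation E E_RDP) (delta_ge0 t) (sum_delta_ge0 s) _
    (fun k => delta_ge0 (x k)) x_le.
  exact/leE.
have /choice[y yE] : forall k, exists b, v k <=E delta b /\ delta b <=E v k.
  by move=> k; have [v0 vt _ _] := v_bd k; exact: interval_delta vt.
have /choice[z zE] : forall k, exists b,
    delta (x k) - v k <=E delta b /\ delta b <=E delta (x k) - v k.
  move=> k; have [v0 _ vx _] := v_bd k; apply: (@interval_delta _ (x k)).
    by apply: (cone_le_of1 vx); fct_ring.
  by apply: (cone_le_of1 v0); fct_ring.
have y_incr : ea_ascending y.
  move=> k; apply/leE; have [vv _] := v_incr k.
  exact: le_trans_cone (le_trans_cone (yE k).2 vv) (yE k.+1).1.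
have z_incr : ea_ascending z.
  move=> k; apply/leE; have [_ vv] := v_incr k.
  exact: le_trans_cone (le_trans_cone (zE k).2 vv) (zE k.+1).1.
have yt k : ea_le (y k) t.
  by apply/leE; have [_ vt _ _] := v_bd k; exact: le_trans_cone (yE k).2 vt.
have zx k : ea_le (z k) (x k).
  apply/leE; have [v0 _ _ _] := v_bd k.
  by apply: (cone_le_of2 cD (zE k).2 v0); fct_ring.
have [b y_sup] := E_sup y_incr (ex_intro _ t yt).
have [|c z_sup] := E_sup z_incr.
  by exists a => k; exact: ea_le_trans (zx k) (x_ub k).
(* [b + c] is defined because [y k + z k] represents [x k], which is below [a]. *)
have [k|d bcd _] := ea_sup_add (c := a) y_incr z_incr y_sup z_sup.
  have /leE xa := x_ub k.
  by apply: (cone_le_of3 cD (yE k).2 (zE k).2 xa); fct_ring.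
have [_ bc_d] := delta_add bcd; have [d_bc _] := delta_add bcd.
have /leE ad : ea_le a d.
  apply: x_lub => k; apply/leE/(le_trans_cone _ bc_d).
  have /leE yb := y_sup.1 k; have /leE zc := z_sup.1 k.
  have yzb : delta (y k) + delta (z k) <=E delta b + delta c.
    by apply: (cone_le_of2 cD yb zc); fct_ring.
  by apply: (cone_le_of3 cD (yE k).1 (zE k).1 yzb); fct_ring.
have /leE bt : ea_le b t by exact: y_sup.2.
have cs : delta c <=E \sum_(b <- s) delta b.
  apply: (ih z) => // k; have [_ _ _ xvs] := v_bd k.
  exact: le_trans_cone (zE k).2 xvs.
apply: (le_trans_cone (le_trans_cone ad d_bc)).
by apply: (cone_le_of2 cD bt cs); fct_ring.
Qed.

(** After a translation the sequence lies between 0 and a finite sum of elements of [E]. By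
    induction on the summands, the part below [t] has a supremum in [E], the rest has one in the
    group, and these add up. *)
Lemma ea_cone_sup_ascending (z : nat -> E -> int) :
  (forall n, z n <=E z n.+1) -> (exists y, forall n, z n <=E y) ->
  exists y, (forall n, z n <=E y) /\ forall w, (forall n, z n <=E w) -> y <=E w.
Proof.
move=> z_incr [y0 z_y0].
wlog z0 : z y0 z_incr z_y0 / forall n, 0 <=E z n.
  move=> H; have [n|n|n|y [zy y_lub]] := H (fun n => z n - z 0%N) (y0 - z 0%N).
  - by apply: (cone_le_of1 (z_incr n)); fct_ring.
  - by apply: (cone_le_of1 (z_y0 n)); fct_ring.
  - have := cone_ascending_le c0 cD z_incr (leq0n n).
    by move=> zz; apply: (cone_le_of1 zz); fct_ring.
  exists (y + z 0%N); split=> [n|w zw].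
    by apply: (cone_le_of1 (zy n)); fct_ring.
  have yw : y <=E w - z 0%N.
    by apply: y_lub => n; apply: (cone_le_of1 (zw n)); fct_ring.
  by apply: (cone_le_of1 yw); fct_ring.
have [s [y0s _]] := cone_le_sum (le_trans_cone (z0 0%N) (z_y0 0%N)).
have {y0 z_y0 y0s} : forall n, z n <=E \sum_(a <- s) delta a.
  by move=> n; exact: le_trans_cone (z_y0 n) y0s.
elim: s z z_incr z0 => [|t s ih] z z_incr z0.
  by rewrite big_nil => zle; exists 0; split=> // w /(_ 0%N); exact: le_trans_cone.
rewrite big_cons => z_le.
have [v [v_bd v_incr]] := ascending_decomposition cD
    (@ea_cone_interpolation E E_RDP) (delta_ge0 t) (sum_delta_ge0 s) z_incr z0 z_le.
have /choice[y yE] : forall k, exists b, v k <=E delta b /\ delta b <=E v k.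
  by move=> k; have [v0 vt _ _] := v_bd k; exact: interval_delta vt.
have y_incr : ea_ascending y.
  move=> k; apply/leE; have [vv _] := v_incr k.
  exact: le_trans_cone (le_trans_cone (yE k).2 vv) (yE k.+1).1.
have [|b y_sup] := E_sup y_incr.
  exists t => k; apply/leE; have [_ vt _ _] := v_bd k.
  exact: le_trans_cone (yE k).2 vt.
have [k|k|k|c [zc c_lub]] := ih (fun k => z k - v k).
- by case: (v_incr k).
- by have [_ _ vz _] := v_bd k; apply: (cone_le_of1 vz); fct_ring.
- by case: (v_bd k).
exists (delta b + c); split=> [k|w zw].
  have /leE yb := y_sup.1 k.
  by apply: (cone_le_of3 cD (yE k).1 yb (zc k)); fct_ring.
have zvy i j : z i - v i + delta (y j) <=E w.
  have zi := cone_ascending_le (s := fun k => z k - v k) c0 cD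
    (fun k => (v_incr k).2) (leq_maxl i j).
  have yj := cone_ascending_le (s := fun k => delta (y k)) c0 cD
    (fun k => (leE _ _).1 (y_incr k)) (leq_maxr i j).
  have [_ yv] := yE (maxn i j).
  have zy : z i - v i + delta (y j) <=E z (maxn i j).
    by apply: (cone_le_of3 cD zi yj yv); fct_ring.
  exact: le_trans_cone zy (zw _).
have bw i : delta b <=E w - (z i - v i).
  apply: (ea_sup_delta_le y_incr y_sup) => j.
  by apply: (cone_le_of1 (zvy i j)); fct_ring.
have cw : c <=E w - delta b.
  by apply: c_lub => i; apply: (cone_le_of1 (bw i)); fct_ring.
by apply: (cone_le_of1 cw); fct_ring.
Qed.

Lemma ea_cone_integrally_closed v w : (forall k, v *+ k <=E w) -> v <=E 0.
Proof.
apply: (cone_integrally_closed c0 cD); first exact: ea_cone_interpolation.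
exact: ea_cone_sup_ascending.
Qed.

End MonotoneSigmaComplete.
(** * Partial states and the tribe *)

Section PartialStates.
Variables (R : realType) (E : effectAlgebra).
Implicit Types (a b c : E) (w : E -> R) (d : nat -> (nat -> E) * E).

(* limit_data lists countably many limits s_j increasing to t_j in E; a partial
   state only has to be normalised, preserve these limits, and be additive and
   [0, 1]-valued on the t_j. Constant sequences put single elements on the list. *)
Definition limit_data d := forall j, ea_increases_to (d j).1 (d j).2.

Definition partial_state d w :=
  [/\ w ea_one = 1, forall j, 0 <= w (d j).2 <= 1,
      forall i j k, ea_add (d i).2 (d j).2 = Some (d k).2 ->
        w (d k).2 = w (d i).2 + w (d j).2
    & forall j, supremums (range (w \o (d j).1)) (w (d j).2)].

Lemma supremumsP (s : nat -> R) x : supremums (range s) x <->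
  (forall i, s i <= x) /\ forall y, (forall i, s i <= y) -> x <= y.
Proof.
split=> [[x_ub x_lub]|[x_ub x_lub]].
  split=> [i|y y_ub]; first by apply: x_ub; exists i.
  by apply: x_lub => _ [i _ <-].
split=> [_ [i _ <-] //|y y_ub]; apply: x_lub => i.
by apply: y_ub; exists i.
Qed.

Lemma exists_inv_le (eps : R) : 0 < eps -> exists n : nat, n.+1%:R^-1 <= eps.
Proof.
move=> eps0; exists (Num.truncn eps^-1).
rewrite -[leRHS]invrK lef_pV2 ?posrE ?invr_gt0 ?ltr0n //.
by rewrite ltW // truncnS_gt.
Qed.

Hypothesis E_RDP : RDP E.
Hypothesis E_sup : forall s : nat -> E, ea_ascending s ->
  (exists b, forall i, ea_le (s i) b) -> exists a, ea_is_sup s a.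

(** By integral closedness some [n.+1] multiple of [a - b] is not below [u]. A generic cone starting
    at [h0] yields [w b + 1 / n.+1 <= w a]; it also makes the differences [f j i], which have
    infimum 0, arbitrarily small, so that [w] preserves the limits. *)
Lemma separating_partial_state d a b : limit_data d -> ~ ea_le a b ->
  exists w, partial_state d w /\ w b < w a.
Proof.
move=> d_lim nab.
have c0 := ea_cone0 E_RDP; have cD := @ea_coneD E E_RDP.
have leE := ea_le_delta E_RDP; have ge0 := delta_ge0 E_RDP.
pose u := delta (ea_one : E).
have leu x : cone_le (@ea_cone E) (delta x) u by apply/leE; exact: ea_le1.
have iclosed := ea_cone_integrally_closed E_RDP E_sup.
have [n nabu] : exists n,
    ~ cone_le (@ea_cone E) (delta a *+ n.+1 - delta b *+ n.+1) u.
  apply: contrapT => H; apply: nab; apply/leE.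
  have ab0 : cone_le (@ea_cone E) (delta a - delta b) 0.
    apply: (iclosed _ u) => -[|n]; first by rewrite mulr0n; exact: ge0.
    apply: contrapT => H'; apply: H; exists n; move: H'.
    by rewrite mulrnBl.
  by apply: (cone_le_of1 ab0); fct_ring.
pose h0 := delta a *+ n.+1 - delta b *+ n.+1 - u.
pose e i := delta (d i).2.
pose f j i := delta (d j).2 - delta ((d j).1 i).
have f_ge0 j i : cone_le (@ea_cone E) 0 (f j i).
  have [_ [/(_ i)/leE H _]] := d_lim j.
  by apply: (cone_le_of1 H); rewrite /f; fct_ring.
have [|||i|i|j i|j i|j i|j l lf|N [[N_le0 ND N_unit Nh0] [N_dec N_inf]]] :=
  @generic_negative_cone E _ c0 cD u (ge0 _) iclosed h0 e f.
- exists n.+1; apply: (cone_le_of3 cD (cone_le_mulrn c0 cD n.+1 (leu a))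
    (cone_mulrn_ge0 c0 cD n.+1 (ge0 b)) (ge0 ea_one)).
  by rewrite /h0 /u; fct_ring.
- exists n.+2; apply: (cone_le_of2 cD (cone_le_mulrn c0 cD n.+1 (leu b))
    (cone_mulrn_ge0 c0 cD n.+1 (ge0 a))).
  by rewrite /h0 /u; fct_ring.
- by move=> H; apply: nabu; apply: (cone_le_of1 H); rewrite /h0; fct_ring.
- exact: ge0.
- exact: leu.
- exact: f_ge0.
- apply: (cone_le_of2 cD (leu (d j).2) (ge0 ((d j).1 i))).
  by rewrite /f; fct_ring.
- have [/(_ i)/leE H _] := d_lim j.
  by apply: (cone_le_of1 H); rewrite /f; fct_ring.
- have [s_incr s_sup] := d_lim j.
  have H : cone_le (@ea_cone E) (delta (d j).2) (delta (d j).2 - l).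
    apply: (ea_sup_delta_le E_RDP E_sup s_incr s_sup) => i.
    by apply: (cone_le_of1 (lf i)); rewrite /f; fct_ring.
  by apply: (cone_le_of1 H); fct_ring.
have N0 : N 0 by apply: N_le0; exact: cone_le_refl.
have Nge0 x : N (- delta x).
  by apply: N_le0; apply: (cone_le_of1 (ge0 x)); fct_ring.
have Nle1 x : N (delta x - u).
  by apply: N_le0; apply: (cone_le_of1 (leu x)); fct_ring.
have Nle v v' : cone_le (@ea_cone E) v v' -> N (v - v').
  by move=> H; apply: N_le0; apply: (cone_le_of1 H); fct_ring.
pose w x := cone_state R N u (delta x).
exists w; split; last first.
  apply: (@lt_le_trans _ _ (w b + n.+1%:R^-1)); first by rewrite ltrDl invr_gt0.
  apply: cone_state_add_inv => //.
  have <- : - h0 = delta b *+ n.+1 + u - delta a *+ n.+1.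
    by rewrite /h0; fct_ring.
  exact: Nh0.
split.
- exact: (cone_state_unit R N0 ND N_unit (Nge0 _)).
- by move=> j; exact: (cone_state_itv R N0 ND N_unit (Nge0 _) (Nle1 _)).
- move=> i j k /(delta_add E_RDP)[kij ijk].
  apply: (cone_stateD R N0 ND N_unit) => //; first exact: Nle.
  + exact: Nle.
  + exact: N_dec.
  + exact: N_dec.
move=> j; apply/supremumsP; split=> [i|y y_ub].
  apply/ler_addgt0Pr => eps eps0.
  have [n' n'eps] := exists_inv_le eps0.
  apply: (@le_trans _ _ (w (d j).2 + n'.+1%:R^-1)); last by rewrite lerD2l.
  apply: cone_state_le_add_inv => //.
  have -> : delta ((d j).1 i) *+ n'.+1 - delta (d j).2 *+ n'.+1 - u =
      - f j i *+ n'.+1 - u by rewrite /f; fct_ring.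
  apply: N_le0; apply: (cone_le_of2 cD
    (cone_mulrn_ge0 c0 cD n'.+1 (f_ge0 j i)) (ge0 ea_one)).
  by rewrite /u; fct_ring.
apply/ler_addgt0Pr => eps eps0.
have [n' n'eps] := exists_inv_le eps0.
(* For this [i], [n'.+1] times the gap between the limit and term [i] is at most [u], so the values
   of [w] differ by at most [1 / n'.+1]. *)
have [i fi] := N_inf j n'.+1.
apply: (@le_trans _ _ (w ((d j).1 i) + n'.+1%:R^-1)).
  apply: cone_state_le_add_inv => //.
  by move: fi; rewrite (_ : f j i *+ n'.+1 - u = delta (d j).2 *+ n'.+1 -
    delta ((d j).1 i) *+ n'.+1 - u) // /f; fct_ring.
by apply: lerD => //; exact: y_ub.
Qed.

End PartialStates.

(** * Properties holding almost everywhere *)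

Section AlmostEverywhere.
Variables (R : realType) (E : effectAlgebra).
Implicit Types (a b c : E) (w : E -> R) (P Q : set (E -> R)).
Implicit Types d : nat -> (nat -> E) * E.

(* The complements of these sets form a sigma-ideal, which plays the role of
   the meager sets. *)
Definition ae_state P :=
  exists2 d, limit_data d & forall w, partial_state d w -> P w.

Lemma partial_state_sub d d' w : (forall j, exists k, d j = d' k) ->
  partial_state d' w -> partial_state d w.
Proof.
move=> dd' [w1 w_itv w_add w_sup]; split=> // [j|i j k|j].
- by have [j' ->] := dd' j.
- have [i' ->] := dd' i; have [j' ->] := dd' j; have [k' ->] := dd' k.
  exact: w_add.
- by have [j' ->] := dd' j.
Qed.

Lemma ae_state_sub P Q : ae_state P -> (forall w, P w -> Q w) -> ae_state Q.
Proof. by move=> [d d_lim dP] PQ; exists d => // w /dP /PQ. Qed.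

Lemma ae_state_countable (P : nat -> set (E -> R)) :
  (forall n, ae_state (P n)) -> ae_state [set w : E -> R | forall n, P n w].
Proof.
move=> H.
have /choice[d dP] : forall n, exists d,
    limit_data d /\ forall w, partial_state d w -> P n w.
  by move=> n; have [d] := H n; exists d.
(* The lists are merged along a coding of pairs; numbers coding no pair repeat entry (0, 0). *)
exists (fun k => let nj := odflt (0%N, 0%N) (unpickle k) in d nj.1 nj.2).
  by move=> k; case: (dP (odflt (0%N, 0%N) (unpickle k)).1).
move=> w w_st n; have [_ ] := dP n; apply.
apply: partial_state_sub w_st => j; exists (pickle (n, j)).
by rewrite pickleK.
Qed.

Lemma ae_stateI P Q : ae_state P -> ae_state Q -> ae_state (P `&` Q).
Proof.
move=> P_ae Q_ae.
have /ae_state_sub :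
    ae_state [set w : E -> R | forall n, (if n is 0%N then P else Q) w].
  by apply: ae_state_countable => -[|n].
by apply=> w PQ; split; [exact: (PQ 0%N)|exact: (PQ 1%N)].
Qed.

(** A finite list of elements, made infinite by repeating [ea_zero]. *)
Definition const_data (s : seq E) j :=
  let a := nth ea_zero s j in (fun _ : nat => a, a).

Lemma const_data_limit (s : seq E) : limit_data (const_data s).
Proof.
move=> j; split=> [i|]; first exact: ea_le_refl.
by split=> [i|b /(_ 0%N)//]; exact: ea_le_refl.
Qed.

Lemma ae_state_one : ae_state [set w : E -> R | w ea_one = 1].
Proof. by exists (const_data [::]) => [|w []]; first exact: const_data_limit. Qed.

Lemma ae_state_itv a : ae_state [set w : E -> R | 0 <= w a <= 1].
Proof.
by exists (const_data [:: a]) => [|w [_ /(_ 0%N)]]; first exact: const_data_limit.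
Qed.

Lemma ae_state_add a b c : ea_add a b = Some c ->
  ae_state [set w : E -> R | w c = w a + w b].
Proof.
move=> abc; exists (const_data [:: a; b; c]); first exact: const_data_limit.
by move=> w [_ _ w_add _]; exact: (w_add 0%N 1%N 2%N).
Qed.

Lemma ae_state_sup (s : nat -> E) a : ea_increases_to s a ->
  ae_state [set w : E -> R | supremums (range (w \o s)) (w a)].
Proof.
move=> s_a; exists (fun=> (s, a)); first by move=> j.
by move=> w [_ _ _ /(_ 0%N)].
Qed.

Lemma ea_hom_le (F : effectAlgebra) (h : E -> F) a b :
  ea_hom h -> ea_le a b -> ea_le (h a) (h b).
Proof. by move=> [_ h_add] [c /h_add]; exists (h c). Qed.

(** If [w] is a partial state for the image under [tau] of the list [d], then [w \o tau] is one for
    [d]. *)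
Lemma ae_state_comp (tau : E -> E) P : ea_hom tau ->
  op_monotone_sigma_complete tau ->
  ae_state P -> ae_state [set w : E -> R | P (w \o tau)].
Proof.
move=> tau_hom tau_sup [d d_lim dP].
exists (fun j => (tau \o (d j).1, tau (d j).2)).
  move=> j; have [s_incr s_sup] := d_lim j; split; last exact: tau_sup.
  by move=> i; apply: ea_hom_le => //; exact: s_incr.
move=> w [w1 w_itv w_add w_sup]; apply: dP; split=> //.
  by rewrite /= tau_hom.1.
by move=> i j k /tau_hom.2; exact: w_add.
Qed.

Section Sup.
Hypothesis E_RDP : RDP E.
Hypothesis E_sup : forall s : nat -> E, ea_ascending s ->
  (exists b, forall i, ea_le (s i) b) -> exists a, ea_is_sup s a.

Lemma ea_le_ae_state a b : ae_state [set w : E -> R | w a <= w b] -> ea_le a b.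
Proof.
move=> [d d_lim dP]; apply: contrapT.
move=> /(separating_partial_state R E_RDP E_sup d_lim).
by move=> [w [/dP /= ab]]; rewrite ltNge ab.
Qed.

Lemma ea_eq_ae_state a b : ae_state [set w : E -> R | w a = w b] -> a = b.
Proof.
by move=> ab; apply: ea_le_anti; apply: ea_le_ae_state; apply: (ae_state_sub ab);
  move=> w /= ->.
Qed.

(** Almost everywhere [w c <= 1], so [w a <= 1 - w b = w b']; hence [a <= b'] and [a + b] is
    defined. Its value is then determined almost everywhere. *)
Lemma ea_add_ae_state a b c : ae_state [set w : E -> R | w a + w b = w c] ->
  ea_add a b = Some c.
Proof.
move=> abc; have [b' [bb' _]] := ea_orthosupp b.
have [|d abd] := ea_add_defined bb' (a := a).
  apply: ea_le_ae_state.
  have := ae_stateI abc (ae_stateI (ae_state_itv c)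
    (ae_stateI (ae_state_add bb') ae_state_one)).
  by move/ae_state_sub; apply=> w [/= abc_w [/= /andP[_ c1] [/= b1 w1]]]; lra.
rewrite abd; congr Some.
apply: ea_eq_ae_state; have := ae_stateI abc (ae_state_add abd).
by move/ae_state_sub; apply=> w [/= <- ->].
Qed.

(** The [s k] ascend and have a supremum [a]. Almost every [w] preserves this limit, so [F w] and
    [w a] are suprema of the same real sequence. *)
Lemma ae_state_pointwise_sup (f : nat -> (E -> R) -> R) (F : (E -> R) -> R)
    (s : nat -> E) :
  (forall k w, f k w <= f k.+1 w) ->
  (forall w, supremums (range (fun k => f k w)) (F w)) ->
  (forall k, ae_state [set w : E -> R | f k w = w (s k)]) ->
  exists2 a, ea_increases_to s a & ae_state [set w : E -> R | F w = w a].
Proof.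
move=> f_incr F_sup f_s.
have s_incr : ea_ascending s.
  move=> k; apply: ea_le_ae_state; have := ae_stateI (f_s k) (f_s k.+1).
  by move/ae_state_sub; apply=> w [/= <- <-]; exact: f_incr.
have [|a s_sup] := E_sup s_incr; first by exists ea_one => i; exact: ea_le1.
exists a; first by split.
have := ae_stateI (ae_state_countable f_s) (ae_state_sup (conj s_incr s_sup)).
move/ae_state_sub; apply=> w [/= fw /supremumsP[a_ub a_lub]].
have /supremumsP[F_ub F_lub] := F_sup w.
apply/eqP; rewrite eq_le F_lub /=; last by move=> i; rewrite fw; exact: a_ub.
by apply: a_lub => i /=; rewrite -fw.
Qed.

End Sup.
End AlmostEverywhere.

(** * Order and suprema in an effect-tribe *)

Section TribeTheory.
Variables (R : realType) (Omega : Type) (T : set (Omega -> R)).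
Hypothesis tribeT : effect_tribe T.
Local Notation TE := (tribe_ea tribeT).
Implicit Types (f g : TE) (s : nat -> TE).

Lemma tribe_leP f g : ea_le f g <-> forall w, val f w <= val g w.
Proof.
split=> [[k /tribe_addP fkg] w|fg].
  by rewrite -fkg lerDl; have /andP[] := tribe_itv tribeT (tribe_memP k) w.
(* The difference [g - f] is in [T] as [1 - (f + (1 - g))]. *)
have := tribe_compl tribeT (tribe_sum tribeT (tribe_memP f)
  (tribe_compl tribeT (tribe_memP g)) _).
move=> /(_ _)/wrap[w|Tk]; first by rewrite opprB addrC subrK.
by exists (tribe_elt Tk); apply/tribe_addP => w /=; ring.
Qed.

Lemma tribe_sup s : ea_ascending s ->
  exists f, forall w, supremums (range (fun k => val (s k) w)) (val f w).
Proof.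
move=> s_incr; pose F w := sup (range (fun k => val (s k) w)).
have F_sup w : supremums (range (fun k => val (s k) w)) (F w).
  have s_ub : has_ubound (range (fun k => val (s k) w)).
    exists 1 => _ [k _ <-].
    by have /andP[] := tribe_itv tribeT (tribe_memP (s k)) w.
  have s_ne : range (fun k => val (s k) w) !=set0 by exists (val (s 0%N) w), 0%N.
  by split=> [|y y_ub]; [exact: sup_upper_bound|exact: ge_sup].
have TF : T F.
  apply: (tribe_lim tribeT (fun k => tribe_memP (s k))) => w; split=> // k.
  by have /tribe_leP := s_incr k.
by exists (tribe_elt TF).
Qed.

Lemma tribe_is_supP s f : ea_ascending s -> ea_is_sup s f <->
  forall w, supremums (range (fun k => val (s k) w)) (val f w).
Proof.
move=> s_incr; have suff_sup g :
    (forall w, supremums (range (fun k => val (s k) w)) (val g w)) -> ea_is_sup s g.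
  move=> g_sup; split=> [i|k k_ub]; apply/tribe_leP => w.
    by have /supremumsP[] := g_sup w.
  have /supremumsP[_] := g_sup w; apply=> i.
  by have /tribe_leP := k_ub i.
split=> [[f_ub f_lub]|]; last exact: suff_sup.
have [g g_sup] := tribe_sup s_incr; have [g_ub g_lub] := suff_sup _ g_sup.
by rewrite (ea_le_anti (f_lub _ g_ub) (g_lub _ f_ub)).
Qed.

Lemma tribe_monotone_sigma_complete : monotone_sigma_complete TE.
Proof.
split=> s s_mono _.
  by have [f f_sup] := tribe_sup s_mono; exists f; exact/tribe_is_supP.
(* Infima are obtained from suprema through the order-reversing involution [compl]. *)
pose compl f : TE := tribe_elt (tribe_compl tribeT (tribe_memP f)).
have complE f g : ea_le f (compl g) -> ea_le g (compl f).
  by move=> /tribe_leP fg; apply/tribe_leP => w; have /= := fg w; lra.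
have complK f : compl (compl f) = f.
  by apply: val_inj; apply/funext => w /=; ring.
have [|f f_sup] := @tribe_sup (compl \o s).
  by move=> k /=; apply/complE; rewrite complK.
have [f_ub f_lub] : ea_is_sup (compl \o s) f.
  by apply/tribe_is_supP => // k /=; apply/complE; rewrite complK.
exists (compl f); split=> [i|g g_lb].
  by rewrite -(complK (s i)); apply/complE; rewrite complK; exact: f_ub.
by apply/complE; apply: f_lub => i /=; apply/complE; rewrite complK.
Qed.

End TribeTheory.

(** * The tribe, its point map and the homomorphism onto [E] *)

Section LoomisSikorski.
Variables (R : realType) (n : nat) (E : effectAlgebra) (tau : E -> E).
Hypothesis Etau : monotone_sigma_complete_n_state n tau.
Hypothesis E_RDP : RDP E.
Implicit Types (a b c : E) (w : E -> R).

Let tau_hom : ea_hom tau. Proof. by have [[]] := Etau. Qed.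
Let tau_iter : iter n tau =1 tau. Proof. by have [[]] := Etau. Qed.
Let E_sup := let: And3 _ E_msc _ := Etau in E_msc.1.
Let tau_sup : op_monotone_sigma_complete tau. Proof. by have [] := Etau. Qed.

Definition ls_tribe : set ((E -> R) -> R) :=
  [set f : (E -> R) -> R | (forall w, 0 <= f w <= 1) /\
           exists a, ae_state [set w : E -> R | f w = w a]].

Lemma ls_tribe_sup (f_ : nat -> (E -> R) -> R) (f : (E -> R) -> R) :
  (forall k, ls_tribe (f_ k)) ->
  (forall w, (forall k, f_ k w <= f_ k.+1 w) /\
             supremums (range (fun k => f_ k w)) (f w)) ->
  ls_tribe f.
Proof.
move=> Tf f_sup; have /choice[s f_s] : forall k, exists a,
    ae_state [set w : E -> R | f_ k w = w a] by move=> k; case: (Tf k).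
have [k w|w|a _ fa] := ae_state_pointwise_sup E_RDP E_sup (F := f) _ _ f_s.
- by case: (f_sup w).
- by case: (f_sup w).
split; last by exists a.
move=> w; have [_ /supremumsP[f_ub f_lub]] := f_sup w; apply/andP; split.
  by apply: le_trans (f_ub 0%N); have [/(_ w)/andP[]] := Tf 0%N.
by apply: f_lub => k; have [/(_ w)/andP[]] := Tf k.
Qed.

Lemma ls_tribe_effect_tribe : effect_tribe ls_tribe.
Proof.
split=> [|f [f01 _]//||f [f01 [a fa]]|f g [f01 [a fa]] [g01 [b gb]] fg|].
- exact: (inhabits (fun=> 0)).
- split=> [w|]; first by rewrite ler01 lexx.
  by exists ea_one; apply: (ae_state_sub (ae_state_one R E)) => w /= ->.
- split=> [w|]; first by have := f01 w; lra.
  have [a' [aa' _]] := ea_orthosupp a; exists a'.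
  have := ae_stateI fa (ae_stateI (ae_state_add R aa') (ae_state_one R E)).
  by move/ae_state_sub; apply=> w [/= -> [/= aw w1]]; lra.
- split=> [w|].
    by have := f01 w; have := g01 w; have := fg w; lra.
  have [b' [bb' _]] := ea_orthosupp b.
  have [|c abc] := ea_add_defined bb' (a := a).
    apply: (ea_le_ae_state (R := R)) => //.
    have := ae_stateI (ae_stateI fa gb)
      (ae_stateI (ae_state_add R bb') (ae_state_one R E)).
    move/ae_state_sub; apply=> w [[/= fw gw] [/= bw w1]].
    by have := fg w; rewrite fw gw; lra.
  exists c.
  have := ae_stateI (ae_stateI fa gb) (ae_state_add R abc).
  by move/ae_state_sub; apply=> w [[/= -> ->] ->].
- exact: ls_tribe_sup.
Qed.

Local Notation tribeT := ls_tribe_effect_tribe.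
Local Notation TE := (tribe_ea tribeT).

Lemma ls_hom_exists : exists h : TE -> E,
  forall f, ae_state [set w : E -> R | val f w = w (h f)].
Proof.
have /choice[h hP] : forall f : TE, exists a,
    ae_state [set w : E -> R | val f w = w a].
  by move=> f; case: (tribe_memP f).
by exists h.
Qed.

(* The upper left corner is the one given by (RDP) in E, truncated so that
   the decomposition holds everywhere. *)
Lemma ls_tribe_RDP : RDP TE.
Proof.
move=> x1 x2 y1 y2 z /tribe_addP xz /tribe_addP yz.
have [h hP] := ls_hom_exists.
have h_add (f g k : TE) : (forall w, val f w + val g w = val k w) ->
    ea_add (h f) (h g) = Some (h k).
  move=> fgk; apply: (ea_add_ae_state (R := R)) => //.
  have := ae_stateI (hP f) (ae_stateI (hP g) (hP k)).
  by move/ae_state_sub; apply=> w [/= <- [/= <- <-]]; exact: fgk.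
have [c11 [c12 [c21 [c22 [cx1 cx2 cy1 cy2]]]]] :=
  E_RDP (h_add _ _ _ xz) (h_add _ _ _ yz).
(* The four entries are nonnegative exactly when the corner is between [max 0 (y1 - x2)] and
   [min x1 y1]; the last one uses [x1 - y2 = y1 - x2]. *)
pose f11 w := Num.max (Num.max 0 (val y1 w - val x2 w))
  (Num.min (Num.min (val x1 w) (val y1 w)) (w c11)).
have itv (f : TE) w : 0 <= val f w <= 1 := tribe_itv tribeT (tribe_memP f) w.
have f11_bd w : [/\ 0 <= f11 w, val y1 w - val x2 w <= f11 w, f11 w <= val x1 w &
    f11 w <= val y1 w].
  have := itv x1 w; have := itv x2 w; have := itv y1 w; have := itv y2 w.
  have := xz w; have := yz w => *.
  by rewrite /f11; split; rewrite ?(le_max, ge_max, le_min, ge_min); lra.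
have all_ae := ae_stateI
  (ae_stateI (ae_stateI (hP x1) (hP x2)) (ae_stateI (hP y1) (hP y2)))
  (ae_stateI
    (ae_stateI (ae_stateI (ae_state_itv R c11) (ae_state_itv R c12))
               (ae_stateI (ae_state_itv R c21) (ae_state_itv R c22)))
    (ae_stateI (ae_stateI (ae_state_add R cx1) (ae_state_add R cx2))
               (ae_stateI (ae_state_add R cy1) (ae_state_add R cy2)))).
have f11_ae : ae_state [set w : E -> R | [/\ f11 w = w c11, val x1 w - f11 w = w c12,
    val y1 w - f11 w = w c21 & val y2 w - (val x1 w - f11 w) = w c22]].
  apply: (ae_state_sub all_ae) => w /=.
  move=> [[[X1 X2] [Y1 Y2]] [[[I11 I12] [I21 I22]] [[C1 C2] [D1 D2]]]].
  have -> : f11 w = w c11.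
    rewrite /f11 /= X1 X2 Y1; apply/eqP.
    by rewrite eq_le !(le_max, ge_max, le_min, ge_min); lra.
  by split=> /=; rewrite ?X1 ?Y1 ?Y2; lra.
have mk (f : (E -> R) -> R) c : (forall w, 0 <= f w <= 1) ->
    ae_state [set w : E -> R | f w = w c] -> ls_tribe f.
  by move=> ? ?; split=> //; exists c.
have T11 : ls_tribe f11.
  apply: (mk _ c11); last by apply: (ae_state_sub f11_ae) => w [].
  by move=> w; have := f11_bd w; have := itv x1 w => ? []; lra.
have T12 : ls_tribe (fun w => val x1 w - f11 w).
  apply: (mk _ c12); last by apply: (ae_state_sub f11_ae) => w [].
  by move=> w; have := f11_bd w; have := itv x1 w => ? []; lra.
have T21 : ls_tribe (fun w => val y1 w - f11 w).
  apply: (mk _ c21); last by apply: (ae_state_sub f11_ae) => w [].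
  by move=> w; have := f11_bd w; have := itv y1 w => ? []; lra.
have T22 : ls_tribe (fun w => val y2 w - (val x1 w - f11 w)).
  apply: (mk _ c22); last by apply: (ae_state_sub f11_ae) => w [].
  move=> w; have := f11_bd w; have := itv x2 w.
  by have := xz w; have := yz w => ? ? ? []; lra.
exists (tribe_elt T11), (tribe_elt T12), (tribe_elt T21), (tribe_elt T22).
by split; apply/tribe_addP => w; have := xz w; have := yz w => /=; lra.
Qed.


Definition ls_point (w : E -> R) : E -> R := w \o tau.

Lemma ls_point_iter : iter n ls_point =1 ls_point.
Proof.
move=> w; have iterE m : iter m ls_point w = w \o iter m tau.
  elim: m => [//|m ih]; rewrite iterS ih.
  by apply/funext => a; rewrite /ls_point /= -iterSr.
by rewrite iterE; apply/funext => a; rewrite /ls_point /= tau_iter.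
Qed.

Lemma ls_tribe_point f : ls_tribe f -> ls_tribe (f \o ls_point).
Proof.
move=> [f01 [a fa]]; split=> [w|]; first exact: f01.
by exists (tau a); exact: (ae_state_comp tau_hom tau_sup fa).
Qed.

Lemma ls_tribe_state_operator :
  monotone_sigma_complete_n_state n (tribe_comp tribeT ls_tribe_point).
Proof.
split; last 2 first.
- exact: tribe_monotone_sigma_complete.
- move=> s f [s_incr /tribe_is_supP -/(_ s_incr) f_sup].
  apply/tribe_is_supP => [k|w]; last exact: (f_sup (ls_point w)).
  by apply/tribe_leP => w; have /tribe_leP := s_incr k; apply.
split; first split.
- exact: val_inj.
- by move=> f g k /tribe_addP fgk; apply/tribe_addP => w; exact: fgk.
move=> f; apply: val_inj; apply/funext => w.
have iterE m : val (iter m (tribe_comp tribeT ls_tribe_point) f) w =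
    val f (iter m ls_point w).
  by elim: m w => [//|m ih] w; rewrite [in RHS]iterSr -ih.
by rewrite iterE ls_point_iter.
Qed.

(** The element [h f] is the only one agreeing with [f] almost everywhere, so each identity for [h]
    is checked almost everywhere. *)
Lemma ls_hom : exists h : TE -> E,
  [/\ state_hom (tribe_comp tribeT ls_tribe_point) tau h,
      hom_monotone_sigma_complete h
    & forall a : E, exists f : TE, h f = a].
Proof.
have [h hP] := ls_hom_exists.
have h_uniq (f : TE) a : ae_state [set w : E -> R | val f w = w a] -> h f = a.
  move=> fa; apply: (ea_eq_ae_state (R := R)) => //.
  have := ae_stateI (hP f) fa.
  by move/ae_state_sub; apply=> w [/= <- <-].
have h_hom : ea_hom h.
  split; first by apply: h_uniq; apply: (ae_state_sub (ae_state_one R E)) => w /= ->.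
  move=> f g k /tribe_addP fgk; apply: (ea_add_ae_state (R := R)) => //.
  have := ae_stateI (hP f) (ae_stateI (hP g) (hP k)).
  by move/ae_state_sub; apply=> w [/= <- [/= <- <-]]; exact: fgk.
exists h; split.
- split=> // f; apply: h_uniq.
  exact: (ae_state_comp tau_hom tau_sup (hP f)).
- move=> s f [s_incr /tribe_is_supP -/(_ s_incr) f_sup].
  have [k w|a hs_a fa] := ae_state_pointwise_sup E_RDP E_sup
    (f := fun k => val (s k)) (F := val f) _ f_sup (fun k => hP (s k)).
  + by have /tribe_leP := s_incr k.
  + by rewrite (h_uniq _ _ fa).
(* A preimage of [a] is evaluation at [a], truncated to [0, 1] because an arbitrary [w] may leave
   that interval. *)
move=> a; have T_a : ls_tribe (fun w => Num.max 0 (Num.min 1 (w a))).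
  split=> [w|]; first by rewrite le_max ge_max le_min ge_min lexx ler01 /= ?lexx.
  exists a; apply: (ae_state_sub (ae_state_itv R a)) => w /= /andP[w0 w1].
  by rewrite min_r // max_r.
exists (tribe_elt T_a); apply: h_uniq.
apply: (ae_state_sub (ae_state_itv R a)) => w /= /andP[w0 w1].
by rewrite min_r // max_r.
Qed.

End LoomisSikorski.
Theorem theorem6p2 (R : realType) (n : nat) (E : effectAlgebra) (tau : E -> E)
    (n_ge1 : (1 <= n)%N)
    (Etau : monotone_sigma_complete_n_state n tau)
    (E_RDP : RDP E) :
  exists (Omega : Type) (T : set (Omega -> R)) (tribeT : effect_tribe T)
    (g : Omega -> Omega) (Tg : forall f : Omega -> R, T f -> T (f \o g)),
    [/\ inhabited Omega,
        RDP (tribe_ea tribeT),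
        iter n g =1 g,
        monotone_sigma_complete_n_state n (tribe_comp tribeT Tg)
      & exists h : tribe_ea tribeT -> E,
          [/\ state_hom (tribe_comp tribeT Tg) tau h,
              hom_monotone_sigma_complete h
            & forall a : E, exists f : tribe_ea tribeT, h f = a]].
Proof.
exists (E -> R), (ls_tribe (R := R) (E := E)), (ls_tribe_effect_tribe R Etau E_RDP).
exists (ls_point tau), (ls_tribe_point Etau); split.
- exact: (inhabits (fun=> 0)).
- exact: ls_tribe_RDP.
- exact: (ls_point_iter Etau).
- exact: ls_tribe_state_operator.
- exact: ls_hom.
Qed.
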